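(* Let $M$ be a $\mathbb Z^2$-module, let $\Gamma:r_1,\dots,r_n$ be a simple (faithful) path in $\mathbb Z^2$, let $\Gamma':r_k,r_{k+1},\dots,r_\ell$ be a subpath of $\Gamma$, and let $n_{\Gamma'}$ be the multiplicity of $\Gamma'$ in $\mathrm{barc}(M_\Gamma)$. Then $$m_{\Gamma'}-\ell_{\Gamma'^+}-\ell_{\Gamma'^-}+m_{\Gamma'^{\pm}}\ \le\ n_{\Gamma'}\ \le\ \ell_{\Gamma'}-m_{\Gamma'^+}-m_{\Gamma'^-}+\ell_{\Gamma'^{\pm}},$$ where the undefined terms in the upper and lower bounds are set to be zero.
   Context: Fix a field $k$; a $\mathbb Z^2$-module is a functor from $\mathbb Z^2$ (product order) to finite-dimensional $k$-vector spaces. For a module $M$ over a connected poset, $\mathrm{rk}(M)$ is the rank of the canonical map $\varprojlim M\to\varinjlim M$ ($i_p\circ\pi_p$ for any $p$, with $\pi_p,i_p$ the structure maps). For a connected subset $I$ of $\mathbb Z^2$, $\mathrm{rk}_M(I):=\mathrm{rk}(M|_I)$. An interval is a nonempty convex connected subset (connected: any two points joined by a sequence in the set with consecutive elements comparable). Write $a\triangleleft b$ if $a<b$ and $\{x:a\le x\le b\}=\{a,b\}$. A path is a nonempty finite sequence $\Gamma:p_1,\dots,p_n$ in $\mathbb Z^2$ with consecutive elements comparable. It is faithful if $p_i\triangleleft p_{i+1}$ or $p_{i+1}\triangleleft p_i$ for each $i$; only faithful paths are considered. It is simple if its points are distinct. $\Gamma$ is viewed as the zigzag poset $p_1\leftrightarrow\cdots\leftrightarrow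 p_n$ and $M_\Gamma$ is the zigzag module obtained by restricting $M$; it is interval-decomposable and $\mathrm{barc}(M_\Gamma)$ is the multiset of intervals of the zigzag poset (i.e. subpaths) in its decomposition. A subpath $\Gamma'\le\Gamma$ is a path of consecutive terms $r_k,\dots,r_\ell$ of $\Gamma$. One- and two-point extensions of $\Gamma':r_k,\dots,r_\ell$ inside $\Gamma:r_1,\dots,r_n$: $\Gamma'^-:r_{k-1},r_k,\dots,r_\ell$ (if $k\ne1$), $\Gamma'^+:r_k,\dots,r_\ell,r_{\ell+1}$ (if $\ell\ne n$), $\Gamma'^\pm:r_{k-1},\dots,r_{\ell+1}$ (if $k\neq1$ and $\ell\ne n$). Interval-hull: $I_\Gamma:=\{q\in\mathbb Z^2:\exists p,r\in\Gamma,\ p\le q\le r\}$. For a finite interval $I$ of $\mathbb Z^2$, list its minimal points $p_0,\dots,p_s$ and its maximal points $q_0,\dots,q_t$, each in increasing order of $x$-coordinate. $\min_{\mathbb{ZZ}}(I)$ is the shortest faithful path containing the sequence $p_0<(p_0\vee p_1)>p_1<(p_1\vee p_2)>\cdots<(p_{s-1}\vee p_s)>p_s$, and $\max_{\mathbb{ZZ}}(I)$ the shortest faithful path containing $q_0>(q_0\wedge q_1)<q_1>\cdots>(q_{t-1}\wedge q_t)<q_t$. $\Gamma^{-1}$ denotes the reversed path. A path $\Gamma$ is tame if [$\min_{\mathbb{ZZ}}(I_\Gamma)\le\Gamma$ or $\min_{\mathbb{ZZ}}(I_\Gamma)^{-1}\le\Gamma$] and [$\max_{\mathbb{ZZ}}(I_\Gamma)\le\Gamma$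 or $\max_{\mathbb{ZZ}}(I_\Gamma)^{-1}\le\Gamma$]. For a simple path $\Gamma$: $m_\Gamma:=\mathrm{rk}_M(I_\Gamma)$ and $\ell_\Gamma:=\min\{\mathrm{rk}(M_{\Gamma''}):\Gamma''\le\Gamma,\ \Gamma''\text{ tame}\}$. *)

(* Defs.v *)
From HB Require Import structures.
From mathcomp Require Import all_boot all_order all_algebra finmap.
From mathcomp Require Import boolp classical_sets.

Set Implicit Arguments.
Unset Strict Implicit.
Unset Printing Implicit Defensive.

Import Order.TTheory GRing.Theory Num.Theory.

Local Open Scope order_scope.
Local Open Scope ring_scope.

Record pmod (k : fieldType) d (P : porderType d) := PMod {
  pspace :> P -> vectType k;
  pmap : forall p q : P, (p <= q)%O -> 'Hom(pspace p, pspace q);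
  pmap_id : forall (p : P) (pp : (p <= p)%O), pmap pp = \1%VF;
  pmap_comp : forall (p q r : P)
      (pq : (p <= q)%O) (qr : (q <= r)%O) (pr : (p <= r)%O),
    pmap pr = (pmap qr \o pmap pq)%VF
}.
Arguments pmap {k d P} M {p q} : rename.

Definition pmod_pull (k : fieldType) d d' (Q : porderType d') (P : porderType d)
    (f : Q -> P) (f_homo : {homo f : x y / (x <= y)%O}) (M : pmod k P) :
    pmod k Q :=
  @PMod k d' Q (fun x => M (f x)) (fun x y xy => pmap M (f_homo x y xy))
    (fun x xx => pmap_id M _) (fun x y z xy yz xz => pmap_comp M _ _ _).

Definition pmod_iso (k : fieldType) d (P : porderType d) (M N : pmod k P) :=
  exists f : forall p, 'Hom(M p, N p),
    (forall p q (pq : (p <= q)%O),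
        (f q \o pmap M pq)%VF = (pmap N pq \o f p)%VF)
    /\ (forall p, bijective (f p)).

Section DirectSum.
Variables (k : fieldType) (d : Order.disp_t) (P : porderType d).

Program Definition pmod0 : pmod k P :=
  @PMod k d P (fun=> 'rV[k]_0) (fun _ _ _ => \1%VF) _ _.
Next Obligation. by rewrite comp_lfun1r. Qed.

Variables M N : pmod k P.

Definition padd_fun p q (pq : (p <= q)%O) (x : M p * N p) : M q * N q :=
  (pmap M pq x.1, pmap N pq x.2).

Fact padd_fun_linear p q (pq : (p <= q)%O) : linear (padd_fun pq).
Proof. by move=> a x y; rewrite /padd_fun /= !linearP. Qed.

HB.instance Definition _ p q (pq : (p <= q)%O) :=
  GRing.isLinear.Build k (M p * N p)%type (M q * N q)%type _ (padd_fun pq)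
    (padd_fun_linear pq).

Program Definition pmod_add : pmod k P :=
  @PMod k d P (fun p => (M p * N p)%type) (fun p q pq => linfun (padd_fun pq))
    _ _.
Next Obligation.
by apply/lfunP=> -[x y]; rewrite !lfunE /= /padd_fun !pmap_id !lfunE.
Qed.
Next Obligation.
apply/lfunP=> -[x y]; rewrite !lfunE /= !lfunE /= /padd_fun /=.
by rewrite !(pmap_comp _ pq qr pr) !lfunE.
Qed.

End DirectSum.

Definition pmod_sum (k : fieldType) d (P : porderType d) (s : seq (pmod k P)) :
    pmod k P :=
  foldr (@pmod_add k d P) (pmod0 k P) s.

Section Intervals.
Variables (d : Order.disp_t) (P : finPOrderType d).

Definition order_convex (J : {set P}) :=
  [forall p in J, forall r in J, forall q, (p <= q <= r)%O ==> (q \in J)].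

Definition order_connected (J : {set P}) :=
  [forall p in J, forall q in J,
     connect (fun x y => [&& x \in J, y \in J & (x >=< y)%O]) p q].

Definition is_interval (J : {set P}) :=
  [&& J != finset.set0, order_convex J & order_connected J].

Definition interval := {J : {set P} | is_interval J}.

Lemma interval_convex (J : interval) p q r :
  p \in val J -> r \in val J -> (p <= q)%O -> (q <= r)%O -> q \in val J.
Proof.
case: J => J /= /and3P[_ /forall_inP cJ _] pJ rJ pq qr.
by have /forall_inP/(_ _ rJ)/forallP/(_ q) := cJ p pJ; rewrite pq qr.
Qed.

Variables (k : fieldType) (J : interval).

(* A row space of dimension 1 on J and 0 elsewhere; the all-ones matrix is the
   identity between two points of J and is empty otherwise. *)
Program Definition interval_mod : pmod k P :=
  @PMod k d P (fun p => 'rV[k]_(p \in val J))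
    (fun p q _ => linfun (mulmxr (const_mx 1 : 'M[k]_(p \in val J, q \in val J))))
    _ _.
Next Obligation.
apply/lfunP=> x; rewrite !lfunE /=.
case: (p \in _) x => x; last by rewrite [x]thinmx0 mul0mx.
suff -> : const_mx 1 = 1%:M :> 'M[k]_1 by rewrite mulmx1.
by apply/matrixP=> i j; rewrite !mxE !ord1 eqxx.
Qed.
Next Obligation.
apply/lfunP=> x; rewrite !lfunE /= !lfunE /= -mulmxA; congr (_ *m _).
have := @interval_convex J p q r; rewrite pq qr.
case: (p \in _) x => [|_] _; last by rewrite flatmx0 [RHS]flatmx0.
case: (r \in _) => [cJ|_]; last by rewrite thinmx0 [RHS]thinmx0.
have -> : q \in val J = true by rewrite cJ.
by apply/matrixP=> i j; rewrite !mxE big_ord1 !mxE mulr1.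
Qed.

End Intervals.

Definition barcode_of (k : fieldType) d (P : finPOrderType d) (M : pmod k P)
    (B : seq (interval P)) :=
  pmod_iso M (pmod_sum [seq interval_mod k J | J <- B]).

(* Some sequence listing the intervals of a decomposition of M with their
   multiplicities; [::] if M is not interval-decomposable. *)
Definition barc (k : fieldType) d (P : finPOrderType d) (M : pmod k P) :
    seq (interval P) :=
  xget [::] [set B | barcode_of M B].

Section Product.
Import VectorInternalTheory.
Variables (k : fieldType) (I : finType) (V : I -> vectType k).
Local Notation D := {dffun forall i, V i}.
Implicit Types f g h : D.

Definition dprod0 : D := [ffun i => 0].
Definition dprod_opp f : D := [ffun i => - f i].
Definition dprod_add f g : D := [ffun i => f i + g i].
Definition dprod_scale (a : k) f : D := [ffun i => a *: f i].

Fact dprod_addA : associative dprod_add.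
Proof. by move=> f g h; apply/ffunP=> i; rewrite !ffunE addrA. Qed.
Fact dprod_addC : commutative dprod_add.
Proof. by move=> f g; apply/ffunP=> i; rewrite !ffunE addrC. Qed.
Fact dprod_add0 : left_id dprod0 dprod_add.
Proof. by move=> f; apply/ffunP=> i; rewrite !ffunE add0r. Qed.
Fact dprod_addN : left_inverse dprod0 dprod_opp dprod_add.
Proof. by move=> f; apply/ffunP=> i; rewrite !ffunE addNr. Qed.

HB.instance Definition _ := GRing.isZmodule.Build D
  dprod_addA dprod_addC dprod_add0 dprod_addN.

Fact dprod_scaleA a b f : dprod_scale a (dprod_scale b f) = dprod_scale (a * b) f.
Proof. by apply/ffunP=> i; rewrite !ffunE scalerA. Qed.
Fact dprod_scale1 : left_id 1 dprod_scale.
Proof. by move=> f; apply/ffunP=> i; rewrite !ffunE scale1r. Qed.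
Fact dprod_scaleDr : right_distributive dprod_scale +%R.
Proof. by move=> a f g; apply/ffunP=> i; rewrite !ffunE scalerDr. Qed.
Fact dprod_scaleDl f : {morph dprod_scale^~ f : a b / a + b}.
Proof. by move=> a b; apply/ffunP=> i; rewrite !ffunE scalerDl. Qed.

HB.instance Definition _ := GRing.Zmodule_isLmodule.Build k D
  dprod_scaleA dprod_scale1 dprod_scaleDr dprod_scaleDl.

Fact dprod_vect_iso :
  Vector.axiom (\sum_(i < #|I|) dim (V (enum_val i))) D.
Proof.
pose n i := dim (V (@enum_val I I i)).
pose F f : 'rV_(\sum_i n i) := \mxrow_i v2r (f (enum_val i)).
pose G (r : 'rV_(\sum_i n i)) : D :=
  [ffun i => ecast i (V i : Type) (enum_rankK i)
    (@r2v k (V (enum_val (enum_rank i))) (submxrow r (enum_rank i)))].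
exists F; first by move=> a f g; apply/rowP=> j; rewrite !mxE !ffunE linearP !mxE.
exists G => [f|r].
  apply/ffunP=> i; rewrite ffunE mxrowK v2rK.
  by move: (enum_rank i) (enum_rankK i) => j e; case: _ / e.
apply/mxrowP=> j; rewrite mxrowK ffunE.
move: (enum_rankK _); rewrite enum_valK => e.
by rewrite (eq_axiomK e) /= r2vK.
Qed.

HB.instance Definition _ := Lmodule_hasFinDim.Build k D dprod_vect_iso.

Definition dprod_proj_fun i f : V i := f i.
Fact dprod_proj_linear i : linear (dprod_proj_fun i).
Proof. by move=> a f g; rewrite /dprod_proj_fun !ffunE. Qed.
HB.instance Definition _ i :=
  GRing.isLinear.Build k D (V i) _ (dprod_proj_fun i) (@dprod_proj_linear i).
Definition dprod_proj i : 'Hom(D, V i) := linfun (dprod_proj_fun i).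

Definition dprod_inj_fun i (x : V i) : D :=
  [ffun j => dfwith (fun l => 0 : V l) x j].
Fact dprod_inj_linear i : linear (@dprod_inj_fun i).
Proof.
move=> a x y; apply/ffunP=> j; rewrite !ffunE.
have [<-|ij] := eqVneq i j; first by rewrite !dfwith_in.
by rewrite !dfwith_out // scaler0 addr0.
Qed.
HB.instance Definition _ i :=
  GRing.isLinear.Build k (V i) D _ (@dprod_inj_fun i) (@dprod_inj_linear i).
Definition dprod_inj i : 'Hom(V i, D) := linfun (@dprod_inj_fun i).

Lemma dprod_projE i f : dprod_proj i f = f i. Proof. by rewrite lfunE. Qed.

Lemma dprod_sum_inj f : f = \sum_i dprod_inj i (f i).
Proof.
apply/ffunP=> j; rewrite -dprod_projE [RHS]/= -[RHS]dprod_projE linear_sum /=.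
rewrite (bigD1 j) //= big1 ?addr0 => [|i ij].
  by rewrite !dprod_projE lfunE ffunE dfwith_in.
by rewrite dprod_projE lfunE ffunE dfwith_out.
Qed.

End Product.

Section Rank.
Variables (k : fieldType) (d : Order.disp_t) (P : finPOrderType d).
Variable M : pmod k P.

Local Notation D := {dffun forall p, M p}.
Local Notation proj := (dprod_proj M).
Local Notation inj := (dprod_inj M).

Definition lim_space : {vspace D} :=
  (\bigcap_(p : P) \bigcap_(q : {q : P | (p <= q)%O})
     lker ((pmap M (valP q) \o proj p)%VF - proj (val q)))%VS.

Definition lim : vectType k := subvs_of lim_space.

Definition lim_proj p : 'Hom(lim, M p) := (proj p \o linfun vsval)%VF.

Definition colim_rel : {vspace D} :=
  (\sum_(p : P) \sum_(q : {q : P | (p <= q)%O})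
     limg ((inj (val q) \o pmap M (valP q))%VF - inj p))%VS.

(* The quotient of the direct sum by colim_rel, realised on a complement of
   colim_rel, onto which the direct sum is projected along colim_rel. *)
Definition colim : vectType k := subvs_of (colim_rel^C)%VS.

Definition colim_pi : 'Hom(D, colim) :=
  (linfun (vsproj colim_rel^C) \o daddv_pi colim_rel^C colim_rel)%VF.

Definition colim_inj p : 'Hom(M p, colim) := (colim_pi \o inj p)%VF.

Definition cone (X : vectType k) (f : forall p, 'Hom(X, M p)) :=
  forall p q (pq : (p <= q)%O), (pmap M pq \o f p)%VF = f q.

Definition cocone (X : vectType k) (f : forall p, 'Hom(M p, X)) :=
  forall p q (pq : (p <= q)%O), (f q \o pmap M pq)%VF = f p.

Lemma lim_spaceP (x : D) :
  reflect (forall p q (pq : (p <= q)%O), pmap M pq (x p) = x q)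
          (x \in lim_space).
Proof.
apply: (iffP idP) => [|xM].
  rewrite memvE => /subv_bigcapP xP p q pq.
  have /subv_bigcapP/(_ (exist _ q pq) isT) := xP p isT.
  rewrite -memvE memv_ker add_lfunE opp_lfunE comp_lfunE /= !dprod_projE.
  rewrite subr_eq0 => /eqP <-.
  congr (fun_of_lfun (pmap M _) _). exact: bool_irrelevance.
rewrite memvE; apply/subv_bigcapP=> p _; apply/subv_bigcapP=> q _.
rewrite -memvE memv_ker add_lfunE opp_lfunE comp_lfunE !dprod_projE xM.
by rewrite subrr.
Qed.

Lemma lim_cone : cone lim_proj.
Proof.
move=> p q pq; apply/lfunP=> x; rewrite lfunE /= /lim_proj !lfunE /= !lfunE /=.
by apply: (elimT (lim_spaceP _)); apply: subvsP.
Qed.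

Lemma lim_univ (X : vectType k) (f : forall p, 'Hom(X, M p)) : cone f ->
  exists! u : 'Hom(X, lim), forall p, (lim_proj p \o u)%VF = f p.
Proof.
move=> fM; pose g := \sum_p (inj p \o f p)%VF.
have gE x p : g x p = f p x.
  rewrite -dprod_projE sum_lfunE linear_sum (bigD1 p) //= big1 ?addr0 => [|q qp].
    by rewrite comp_lfunE dprod_projE lfunE ffunE dfwith_in.
  by rewrite comp_lfunE dprod_projE lfunE ffunE dfwith_out.
have gL x : g x \in lim_space.
  by apply/lim_spaceP=> p q pq; rewrite !gE -(fM _ _ pq) comp_lfunE.
exists (linfun (vsproj lim_space) \o g)%VF; split=> [p|u uf]; apply/lfunP=> x.
  rewrite /lim_proj !comp_lfunE dprod_projE [linfun vsval _]lfunE.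
  by rewrite [linfun (vsproj _) _]lfunE /= vsprojK // gE.
apply/val_inj/ffunP=> p; rewrite comp_lfunE lfunE /= vsprojK // gE -uf.
by rewrite !comp_lfunE dprod_projE lfunE.
Qed.

Lemma colim_pi_ker x : (colim_pi x == 0) = (x \in colim_rel).
Proof.
have cI : (colim_rel^C :&: colim_rel = 0)%VS by rewrite capvC capv_compl.
have cI' : (colim_rel :&: colim_rel^C = 0)%VS by rewrite capv_compl.
have xE : daddv_pi colim_rel^C colim_rel x + daddv_pi colim_rel colim_rel^C x = x.
  by apply: daddv_pi_add => //; rewrite addvC addv_complf memvf.
rewrite comp_lfunE lfunE /=; apply/eqP/idP=> [x0|xR].
  rewrite -xE -[X in X + _](vsprojK (memv_pi _ _ _)) x0 linear0 add0r.
  exact: memv_pi.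
have -> : daddv_pi colim_rel^C colim_rel x = 0; last exact: linear0.
by apply: (addIr x); rewrite add0r -[RHS]xE (daddv_pi_id cI' xR).
Qed.

Lemma colim_pi_id (x : colim) : colim_pi (vsval x) = x.
Proof.
apply: val_inj; rewrite comp_lfunE lfunE /= vsprojK ?memv_pi //.
by rewrite daddv_pi_id ?subvsP // capvC capv_compl.
Qed.

Lemma colim_cocone : cocone colim_inj.
Proof.
move=> p q pq; apply/lfunP=> x; apply/eqP.
have xR : (inj q (pmap M pq x) - inj p x) \in colim_rel.
  rewrite memvE; apply: (sumv_sup p) => //.
  apply: (sumv_sup (exist (fun r => (p <= r)%O) q pq)) => //.
  rewrite -memvE; apply/memv_imgP; exists x; first exact: memvf.
  rewrite add_lfunE opp_lfunE comp_lfunE; congr (inj q (fun_of_lfun (pmap M _) _) - _).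
  exact: bool_irrelevance.
have := xR; by rewrite -colim_pi_ker linearB /= subr_eq0 comp_lfunE !comp_lfunE.
Qed.

Lemma colim_univ (X : vectType k) (f : forall p, 'Hom(M p, X)) : cocone f ->
  exists! u : 'Hom(colim, X), forall p, (u \o colim_inj p)%VF = f p.
Proof.
move=> fM; pose g : 'Hom(D, X) := \sum_p (f p \o proj p)%VF.
have g_inj p x : g (inj p x) = f p x.
  rewrite sum_lfunE (bigD1 p) //= big1 ?addr0 => [|q qp].
    by rewrite comp_lfunE dprod_projE lfunE ffunE dfwith_in.
  by rewrite comp_lfunE dprod_projE lfunE ffunE dfwith_out ?linear0 1?eq_sym.
have g_rel x : x \in colim_rel -> g x = 0.
  suff sub : (colim_rel <= lker g)%VS by move/(subvP sub); rewrite memv_ker => /eqP.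
  apply/subv_sumP=> p _; apply/subv_sumP=> q _; apply/subvP=> _ /memv_imgP[y _ ->].
  rewrite memv_ker add_lfunE opp_lfunE comp_lfunE linearB /= !g_inj.
  by rewrite -(fM _ _ (valP q)) comp_lfunE subrr.
have colimE x : g x = g (vsval (colim_pi x)).
  apply/eqP; rewrite -subr_eq0 -linearB; apply/eqP/g_rel.
  by rewrite -colim_pi_ker linearB /= colim_pi_id subrr.
exists (g \o linfun vsval)%VF; split=> [p|u uf]; apply/lfunP=> x.
  rewrite comp_lfunE [colim_inj p x]comp_lfunE -[RHS]g_inj [RHS]colimE.
  by rewrite comp_lfunE [linfun vsval _]lfunE.
rewrite -{2}[x]colim_pi_id comp_lfunE [linfun vsval _]lfunE /=.
rewrite (dprod_sum_inj (vsval x)) !linear_sum /=.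
by apply: eq_bigr => p _; rewrite g_inj -uf comp_lfunE [colim_inj p _]comp_lfunE.
Qed.

Definition lim_to_colim p : 'Hom(lim, colim) := (colim_inj p \o lim_proj p)%VF.

Lemma lim_to_colim_connect p q :
  connect (fun x y => (x >=< y)%O) p q -> lim_to_colim p = lim_to_colim q.
Proof.
have le_eq x y : (x <= y)%O -> lim_to_colim x = lim_to_colim y.
  by move=> xy; rewrite /lim_to_colim -(colim_cocone xy) -(lim_cone xy) comp_lfunA.
case/connectP=> s; elim: s p => [|x s IHs] p /= => [_ -> //|/andP[px xs] qE].
by rewrite -(IHs x xs qE); case/orP: px => /le_eq.
Qed.

(* Independent of the point of P when P is connected, by lim_to_colim_connect;
   the empty poset has rank 0. *)
Definition rk : nat :=
  if [pick p : P] is Some p then \dim (limg (lim_to_colim p)) else 0%N.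

End Rank.

Definition subposet d (P : porderType d) (A : {fset P}) : Type := A.

HB.instance Definition _ d (P : porderType d) (A : {fset P}) :=
  SubFinite.copy (subposet A) A.
HB.instance Definition _ d (P : porderType d) (A : {fset P}) :=
  [SubChoice_isSubPOrder of subposet A by <: with d].

Definition restrict (k : fieldType) d (P : porderType d) (M : pmod k P)
    (A : {fset P}) : pmod k (subposet A) :=
  pmod_pull (f := val : subposet A -> P) (fun x y xy => xy) M.

Section Zigzag.
Variables (d : Order.disp_t) (P : porderType d) (G : seq P).

(* The positions of G, ordered by the zigzag p_1 <-> ... <-> p_n and not by the
   order induced from P, under which distant points may also be comparable. *)
Definition zz : Type := 'I_(size G).
HB.instance Definition _ := Finite.on zz.

Definition zz_point (i : zz) : P := tnth (in_tuple G) i.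

Definition zz_arrow (i j : zz) :=
  ((i.+1 == j)%N || (j.+1 == i)%N) && (zz_point i < zz_point j)%O.

Definition zz_le : rel zz := connect zz_arrow.

Fact zz_le_point i j : zz_le i j -> i != j -> (zz_point i < zz_point j)%O.
Proof.
case/connectP=> s; elim: s i => [|x s IHs] i /= => [_ ->|]; first by rewrite eqxx.
case/andP=> /andP[_ ix] xs jE _.
have [<- //|xj] := eqVneq x j.
exact: lt_trans ix (IHs _ xs jE xj).
Qed.

Fact zz_le_anti : antisymmetric zz_le.
Proof.
move=> i j /andP[ij ji]; apply/eqP/negPn/negP => neq.
have := lt_trans (zz_le_point ij neq) (zz_le_point ji _).
by rewrite ltxx eq_sym neq => /(_ isT).
Qed.

HB.instance Definition _ := Order.Le_isPOrder.Build d zz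
  (@connect0 _ zz_arrow) zz_le_anti (@connect_trans _ zz_arrow).

Fact zz_point_homo : {homo zz_point : i j / (i <= j)%O}.
Proof.
move=> i j ij; have [->//|neq] := eqVneq i j.
exact: ltW (zz_le_point ij neq).
Qed.

End Zigzag.

Definition zz_mod (k : fieldType) d (P : porderType d) (M : pmod k P)
    (G : seq P) : pmod k (zz G) :=
  pmod_pull (@zz_point_homo d P G) M.

Definition Z2 := (int *p int)%type.

Section Paths.
Implicit Types (p q r : Z2) (G L : seq Z2) (I : {fset Z2}).

Definition covers p q : bool :=
  (p < q)%O && `[< forall x, (p <= x <= q)%O -> x = p \/ x = q >].

Definition faithful_path G : bool :=
  (G != [::]) && sorted (fun p q => covers p q || covers q p) G.

Definition box p q : seq Z2 :=
  [seq x <- [seq ((p.1 + i%:Z, p.2 + j%:Z) : Z2)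
              | i <- iota 0 `|q.1 - p.1|.+1, j <- iota 0 `|q.2 - p.2|.+1]
   | (p <= x <= q)%O].

Definition hull G : {fset Z2} :=
  [fset x in flatten [seq box p r | p <- G, r <- G]]%fset.

Lemma mem_box p q x : (x \in box p q) = (p <= x <= q)%O.
Proof.
have diff (u v w : int) : u <= v -> v <= w ->
    (`|v - u|%N \in iota 0 `|w - u|.+1) /\ u + `|v - u|%N%:Z = v.
  move=> uv vw; have uw := le_trans uv vw.
  rewrite mem_iota leq0n add0n ltnS -lez_nat !gez0_abs ?subr_ge0 //.
  by rewrite lerB // [u + _]addrC subrK.
rewrite mem_filter; case: (boolP (p <= x <= q)%O) => // /andP[].
case: p q x => [p1 p2] [q1 q2] [x1 x2] /andP[p1x p2x] /andP[xq1 xq2].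
have [x1i x1E] := diff _ _ _ p1x xq1; have [x2i x2E] := diff _ _ _ p2x xq2.
rewrite andTb; apply/allpairsPdep; exists `|x1 - p1|%N, `|x2 - p2|%N.
by split=> //; congr (_, _).
Qed.

Lemma hullP G q :
  reflect (exists p r, [/\ p \in G, r \in G & (p <= q <= r)%O]) (q \in hull G).
Proof.
rewrite !inE; apply: (iffP flattenP) => [[_ /allpairsPdep[p [r [pG rG ->]]]]|].
  by rewrite mem_box => pqr; exists p, r.
case=> p [r [pG rG pqr]]; exists (box p r); last by rewrite mem_box.
by apply/allpairsPdep; exists p, r.
Qed.

Definition min_points I : seq Z2 :=
  sort (fun p q => (p.1 <= q.1)%R)
    [seq p <- enum_fset I | all (fun q => ~~ (q < p)%O) (enum_fset I)].

Definition max_points I : seq Z2 :=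
  sort (fun p q => (p.1 <= q.1)%R)
    [seq p <- enum_fset I | all (fun q => ~~ (p < q)%O) (enum_fset I)].

(* p_0, op p_0 p_1, p_1, op p_1 p_2, ..., p_s *)
Definition corners (op : Z2 -> Z2 -> Z2) (s : seq Z2) : seq Z2 :=
  if s is p :: s' then p :: flatten (pairmap (fun a b => [:: op a b; b]) p s')
  else [::].

Definition shortest_through (s L : seq Z2) : Prop :=
  [/\ faithful_path L, subseq s L &
      forall L', faithful_path L' -> subseq s L' -> (size L <= size L')%N].

Definition is_min_ZZ I L := shortest_through (corners Order.join (min_points I)) L.
Definition is_max_ZZ I L := shortest_through (corners Order.meet (max_points I)) L.

(* is_min_ZZ I and is_max_ZZ I determine L when I is an interval: consecutive
   corners lie on a horizontal or vertical line. *)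
Definition tame G : Prop :=
  (exists2 L, is_min_ZZ (hull G) L & infix L G || infix (rev L) G) /\
  (exists2 L, is_max_ZZ (hull G) L & infix L G || infix (rev L) G).

(* Positions are numbered from 0. *)
Definition subpath G a b : seq Z2 := take (b.+1 - a) (drop a G).

Definition subpaths G : seq (seq Z2) :=
  [seq subpath G a b | a <- iota 0 (size G), b <- iota a (size G - a)].

Definition ext_plus G a b :=
  if (b.+1 < size G)%N then Some (subpath G a b.+1) else None.
Definition ext_minus G a b :=
  if (0 < a)%N then Some (subpath G a.-1 b) else None.
Definition ext_pm G a b :=
  if (0 < a)%N && (b.+1 < size G)%N then Some (subpath G a.-1 b.+1) else None.

End Paths.

Section Bounds.
Variables (k : fieldType) (M : pmod k Z2).
Implicit Type G : seq Z2.

Definition m_rk G : nat := rk (restrict M (hull G)).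

(* A singleton subpath is tame, so for nonempty G the sequence of ranks below is
   nonempty and its head plays no role in the minimum. *)
Definition l_rk G : nat :=
  let rs := [seq rk (zz_mod M L) | L <- subpaths G & `[< tame L >]] in
  \big[minn/head 0%N rs]_(r <- rs) r.

(* None stands for an extension that does not exist; its terms are zero. *)
Definition m_opt (o : option (seq Z2)) : int := oapp (fun G => (m_rk G)%:Z) 0 o.
Definition l_opt (o : option (seq Z2)) : int := oapp (fun G => (l_rk G)%:Z) 0 o.

Definition mult G a b : nat :=
  count (fun J => val J == [set i : zz G | (a <= i <= b)%N]) (barc (zz_mod M G)).

End Bounds.

(* Main.v *)
Require Import Defs.
From mathcomp Require Import all_boot all_order all_algebra finmap.
From mathcomp Require Import boolp classical_sets.
From HB Require Import structures.
From mathcomp Require Import zify.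
Import Order.TTheory GRing.Theory Num.Theory.

(* A zigzag module is a direct sum of interval modules, the rank is additive,
   and a subpath has rank 1 on the intervals containing it and 0 on the others;
   hence by inclusion-exclusion
     n_{G'} = rk G' - rk G'^+ - rk G'^- + rk G'^{+-}.
   Since lim -> colim factors through restriction, m_L <= rk L (from the hull of L
   to L) and rk L <= l_L (from L to its subpaths), which gives both bounds.

   For the interval decomposition, choose [s, e] maximal among the ranges of
   positions carrying a section x of M and a section xi of the dual of M with
   xi x <> 0. If the arrow at the end e leaves [s, e], maximality allows x to be
   corrected so that it dies along this arrow; if it enters [s, e], xi can be
   corrected so that it vanishes on its image. Both corrections vanish at s, so
   that the pairing is unchanged and the two ends can be treated in turn. Then
   x and xi extend by zero to maps k_[s,e] -> M -> k_[s,e] with nonzero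
   composite, so k_[s,e] is a direct summand. *)

Set Implicit Arguments.
Unset Strict Implicit.
Unset Printing Implicit Defensive.

Local Open Scope order_scope.
Local Open Scope ring_scope.

Local Notation pmap := Defs.pmap.

(** * Ranks *)

Section Ranks.
Variable k : fieldType.

Definition is_connected d (P : finPOrderType d) :=
  forall p q : P, connect (fun x y => (x >=< y)%O) p q.

Definition natural d (P : porderType d) (M N : pmod k P)
    (f : forall p, 'Hom(M p, N p)) :=
  forall p q (pq : (p <= q)%O), (f q \o pmap M pq)%VF = (pmap N pq \o f p)%VF.

Lemma rkE d (P : finPOrderType d) (M : pmod k P) (p : P) : is_connected P ->
  rk M = \dim (limg (lim_to_colim M p)).
Proof.
move=> cP; rewrite /rk; case: pickP => [q _|/(_ p) //].
by rewrite (lim_to_colim_connect M (cP q p)).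
Qed.

Lemma comp_eqE (X Y Z : vectType k) (f : 'Hom(Y, Z)) (g : 'Hom(X, Y)) h :
  (f \o g = h)%VF -> forall x, f (g x) = h x.
Proof. by move=> <- x; rewrite comp_lfunE. Qed.

Lemma lim_to_colimE d (P : finPOrderType d) (M : pmod k P) p x :
  lim_to_colim M p x = colim_inj M p (lim_proj M p x).
Proof. exact: comp_lfunE. Qed.

Lemma dim_limg_le (U V : vectType k) (f : 'Hom(U, V)) (W : {vspace U}) :
  (\dim (f @: W) <= \dim W)%N.
Proof. by rewrite -(limg_ker_dim f W) leq_addl. Qed.

(** The maps [u] induce [lim M -> lim N] and the maps [v] induce [colim N -> colim M]. As
    [v q \o u q] is the identity, the canonical map of [M] is that of [N] composed with these two,
    so its rank is no larger. *)
Lemma rk_le d d' (P : finPOrderType d) (Q : finPOrderType d')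
    (M : pmod k P) (N : pmod k Q) (f : Q -> P)
    (u : forall q, 'Hom(M (f q), N q)) (v : forall q, 'Hom(N q, M (f q)))
    (q : Q) : is_connected P -> is_connected Q ->
  (forall q r (qr : (q <= r)%O), exists2 fqr : (f q <= f r)%O,
     (u r \o pmap M fqr = pmap N qr \o u q)%VF &
     (v r \o pmap N qr = pmap M fqr \o v q)%VF) ->
  (forall q, (v q \o u q = \1)%VF) ->
  (rk M <= rk N)%N.
Proof.
move=> cP cQ uv vu; rewrite (rkE _ (f q) cP) (rkE _ q cQ).
have [|a [aE _]] := @lim_univ _ _ _ N _ (fun q => u q \o lim_proj M (f q))%VF.
  move=> r s rs; have [frs uE _] := uv _ _ rs.
  by rewrite comp_lfunA -uE -comp_lfunA (@lim_cone _ _ _ M _ _ frs).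
have [|b [bE _]] := @colim_univ _ _ _ N _ (fun q => colim_inj M (f q) \o v q)%VF.
  move=> r s rs; have [frs _ vE] := uv _ _ rs.
  by rewrite -comp_lfunA vE comp_lfunA (@colim_cocone _ _ _ M _ _ frs).
have -> : lim_to_colim M (f q) = (b \o lim_to_colim N q \o a)%VF.
  apply/lfunP=> x; rewrite 2!comp_lfunE !lim_to_colimE.
  rewrite (comp_eqE (aE q)) (comp_eqE (bE q)) [RHS]comp_lfunE.
  by rewrite [(u q \o _)%VF x]comp_lfunE (comp_eqE (vu q)) id_lfunE.
rewrite limg_comp limg_comp; apply: leq_trans (dim_limg_le _ _) _.
exact/dimvS/limgS/subvf.
Qed.

Lemma lim_map d (P : finPOrderType d) (M N : pmod k P)
    (f : forall p, 'Hom(M p, N p)) : natural f ->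
  exists h : 'Hom(lim M, lim N),
    forall p, (lim_proj N p \o h = f p \o lim_proj M p)%VF.
Proof.
move=> fN.
have [|h [hE _]] := @lim_univ _ _ _ N _ (fun p => f p \o lim_proj M p)%VF.
  by move=> p q pq; rewrite comp_lfunA -fN -comp_lfunA lim_cone.
by exists h.
Qed.

Lemma colim_map d (P : finPOrderType d) (M N : pmod k P)
    (f : forall p, 'Hom(M p, N p)) : natural f ->
  exists h : 'Hom(colim M, colim N),
    forall p, (h \o colim_inj M p = colim_inj N p \o f p)%VF.
Proof.
move=> fN.
have [|h [hE _]] := @colim_univ _ _ _ M _ (fun p => colim_inj N p \o f p)%VF.
  by move=> p q pq; rewrite -comp_lfunA fN comp_lfunA colim_cocone.
by exists h.
Qed.

Section Biproduct.
Variables (d : Order.disp_t) (P : finPOrderType d) (M N : pmod k P).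

Definition pinl_fun p (x : M p) : M p * N p := (x, 0).
Definition pinr_fun p (x : N p) : M p * N p := (0, x).
Fact pinl_linear p : linear (@pinl_fun p).
Proof. by move=> a x y; rewrite /pinl_fun -[RHS]/(_, _) /= scaler0 addr0. Qed.
Fact pinr_linear p : linear (@pinr_fun p).
Proof. by move=> a x y; rewrite /pinr_fun -[RHS]/(_, _) /= scaler0 addr0. Qed.
HB.instance Definition _ p :=
  GRing.isLinear.Build k _ _ _ (@pinl_fun p) (@pinl_linear p).
HB.instance Definition _ p :=
  GRing.isLinear.Build k _ _ _ (@pinr_fun p) (@pinr_linear p).

Definition pinl p : 'Hom(M p, pmod_add M N p) := linfun (@pinl_fun p).
Definition pinr p : 'Hom(N p, pmod_add M N p) := linfun (@pinr_fun p).
Definition pfst p : 'Hom(pmod_add M N p, M p) := linfun (fst : M p * N p -> M p).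
Definition psnd p : 'Hom(pmod_add M N p, N p) := linfun (snd : M p * N p -> N p).

Lemma pinlE p x : pinl p x = (x, 0). Proof. exact: lfunE. Qed.
Lemma pinrE p x : pinr p x = (0, x). Proof. exact: lfunE. Qed.
Lemma pfstE p x : pfst p x = x.1. Proof. exact: lfunE. Qed.
Lemma psndE p x : psnd p x = x.2. Proof. exact: lfunE. Qed.
Lemma pmod_addE p q (pq : (p <= q)%O) x :
  pmap (pmod_add M N) pq x = (pmap M pq x.1, pmap N pq x.2).
Proof. exact: lfunE. Qed.

(** Limits and colimits are functorial, so the inclusions and projections of the sum pass to them
    and split the image of the canonical map into the images for [M] and [N]. *)
Lemma rk_add (p : P) : is_connected P -> rk (pmod_add M N) = (rk M + rk N)%N.
Proof.
move=> cP; rewrite !(rkE _ p cP).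
have [|l1 l1E] := @lim_map _ _ M (pmod_add M N) pinl.
  move=> q r qr; apply/lfunP=> x.
  by rewrite !comp_lfunE pmod_addE !pinlE linear0.
have [|l2 l2E] := @lim_map _ _ N (pmod_add M N) pinr.
  move=> q r qr; apply/lfunP=> x.
  by rewrite !comp_lfunE pmod_addE !pinrE linear0.
have [|m1 m1E] := @lim_map _ _ (pmod_add M N) M pfst.
  move=> q r qr; apply/lfunP=> x.
  by rewrite !comp_lfunE pmod_addE !pfstE.
have [|m2 m2E] := @lim_map _ _ (pmod_add M N) N psnd.
  move=> q r qr; apply/lfunP=> x.
  by rewrite !comp_lfunE pmod_addE !psndE.
have [|c1 c1E] := @colim_map _ _ M (pmod_add M N) pinl.
  move=> q r qr; apply/lfunP=> x.
  by rewrite !comp_lfunE pmod_addE !pinlE linear0.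
have [|c2 c2E] := @colim_map _ _ N (pmod_add M N) pinr.
  move=> q r qr; apply/lfunP=> x.
  by rewrite !comp_lfunE pmod_addE !pinrE linear0.
have [|n1 n1E] := @colim_map _ _ (pmod_add M N) M pfst.
  move=> q r qr; apply/lfunP=> x.
  by rewrite !comp_lfunE pmod_addE !pfstE.
have [|n2 n2E] := @colim_map _ _ (pmod_add M N) N psnd.
  move=> q r qr; apply/lfunP=> x.
  by rewrite !comp_lfunE pmod_addE !psndE.
(* [n1] and [n2] are retractions of [c1] and [c2]; checking this on the images of the canonical maps
   is enough for the dimension count. *)
have n11 x : n1 (c1 (lim_to_colim M p x)) = lim_to_colim M p x.
  rewrite lim_to_colimE (comp_eqE (c1E p)) [X in n1 X]comp_lfunE.
  by rewrite (comp_eqE (n1E p)) [LHS]comp_lfunE pinlE pfstE.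
have n22 x : n2 (c2 (lim_to_colim N p x)) = lim_to_colim N p x.
  rewrite lim_to_colimE (comp_eqE (c2E p)) [X in n2 X]comp_lfunE.
  by rewrite (comp_eqE (n2E p)) [LHS]comp_lfunE pinrE psndE.
have n12 x : n1 (c2 (lim_to_colim N p x)) = 0.
  rewrite lim_to_colimE (comp_eqE (c2E p)) [X in n1 X]comp_lfunE.
  by rewrite (comp_eqE (n1E p)) [LHS]comp_lfunE pinrE pfstE linear0.
have lc1 x : c1 (lim_to_colim M p x) = lim_to_colim (pmod_add M N) p (l1 x).
  rewrite !lim_to_colimE (comp_eqE (c1E p)) (comp_eqE (l1E p)).
  by rewrite [LHS]comp_lfunE [X in _ = _ X]comp_lfunE.
have lc2 x : c2 (lim_to_colim N p x) = lim_to_colim (pmod_add M N) p (l2 x).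
  rewrite !lim_to_colimE (comp_eqE (c2E p)) (comp_eqE (l2E p)).
  by rewrite [LHS]comp_lfunE [X in _ = _ X]comp_lfunE.
(* A point [x] of the limit is compared with [l1 (m1 x) + l2 (m2 x)] after projection to [p],
   through which the canonical map factors. *)
have -> : limg (lim_to_colim (pmod_add M N) p) =
    (c1 @: limg (lim_to_colim M p) + c2 @: limg (lim_to_colim N p))%VS.
  apply/eqP; rewrite eqEsubv; apply/andP; split.
    apply/subvP=> _ /memv_imgP[x _ ->]; apply/memv_addP.
    exists (c1 (lim_to_colim M p (m1 x))); first by rewrite !memv_img ?memvf.
    exists (c2 (lim_to_colim N p (m2 x))); first by rewrite !memv_img ?memvf.
    rewrite lc1 lc2 !lim_to_colimE -linearD; congr (colim_inj _ _ _).
    rewrite (comp_eqE (l1E p)) (comp_eqE (l2E p)).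
    rewrite [X in _ = X + _]comp_lfunE [X in _ = _ + X]comp_lfunE.
    rewrite (comp_eqE (m1E p)) (comp_eqE (m2E p)).
    rewrite [X in pinl _ X]comp_lfunE [X in pinr _ X]comp_lfunE.
    by rewrite pinlE pinrE pfstE psndE; case: (lim_proj _ _ _) => y z;
      rewrite -[RHS]/(_, _) /= addr0 add0r.
  rewrite subv_add; apply/andP; split.
    apply/subvP=> _ /memv_imgP[_ /memv_imgP[x _ ->] ->].
    by rewrite lc1 memv_img ?memvf.
  apply/subvP=> _ /memv_imgP[_ /memv_imgP[x _ ->] ->].
  by rewrite lc2 memv_img ?memvf.
(* The retractions make [c1] and [c2] injective on the two images; [n12] makes the resulting
   subspaces independent. *)
rewrite dimv_disjoint_sum.
  congr addn; apply/limg_dim_eq/eqP; rewrite -subv0; apply/subvP=> y.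
    case/memv_capP=> /memv_imgP[x _ ->]; rewrite memv_ker => /eqP c0.
    by rewrite -n11 c0 linear0 mem0v.
  case/memv_capP=> /memv_imgP[x _ ->]; rewrite memv_ker => /eqP c0.
  by rewrite -n22 c0 linear0 mem0v.
apply/eqP; rewrite -subv0; apply/subvP=> y /memv_capP[].
case/memv_imgP=> u /memv_imgP[x _ uE] yE /memv_imgP[v /memv_imgP[z _ vE] yE'].
by rewrite yE uE -n11 -uE -yE yE' vE n12 linear0 mem0v.
Qed.

End Biproduct.
End Ranks.

(** * Isomorphisms, pullbacks and estimates of the rank *)

Section Isomorphisms.
Variable k : fieldType.

Lemma naturalE d (P : porderType d) (M N : pmod k P)
    (f : forall p, 'Hom(M p, N p)) p q (pq : (p <= q)%O) x :
  natural f -> f q (pmap M pq x) = pmap N pq (f p x).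
Proof. by move=> fN; rewrite -!comp_lfunE fN. Qed.

(** The linear inverses commute with the structure maps because [f] does and can be cancelled, being
    injective. *)
Lemma pmod_iso_inverse d (P : porderType d) (M N : pmod k P) : pmod_iso M N ->
  exists f : forall p, 'Hom(M p, N p), exists g : forall p, 'Hom(N p, M p),
    [/\ natural f, natural g, forall p, (f p \o g p = \1)%VF &
        forall p, (g p \o f p = \1)%VF].
Proof.
case=> f [fN f_bij]; exists f, (fun p => (f p)^-1%VF).
have ker0 p : lker (f p) == 0%VS by apply/lker0P/bij_inj.
have fK p : (f p \o (f p)^-1 = \1)%VF.
  apply/lfunP=> y; rewrite comp_lfunE id_lfunE limg_lfunVK //.
  by case: (f_bij p) => h _ hK; rewrite -(hK y) memv_img ?memvf.
split=> // [p q pq|p]; last exact: lker0_compVf.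
apply/lfunP=> y; rewrite !comp_lfunE -{1}[y]id_lfunE -(fK p) comp_lfunE.
by rewrite -(naturalE _ _ fN) lker0_lfunK.
Qed.

Lemma pmod_iso_trans d (P : porderType d) (M N L : pmod k P) :
  pmod_iso M N -> pmod_iso N L -> pmod_iso M L.
Proof.
case=> f [fN f_bij] [g [gN g_bij]]; exists (fun p => g p \o f p)%VF.
split=> [p q pq|p].
  by rewrite -comp_lfunA fN !comp_lfunA gN.
apply: (eq_bij (bij_comp (g_bij p) (f_bij p))) => x; by rewrite comp_lfunE.
Qed.

Lemma pmod_iso_add d (P : finPOrderType d) (K M N : pmod k P) :
  pmod_iso M N -> pmod_iso (pmod_add K M) (pmod_add K N).
Proof.
case/pmod_iso_inverse=> f [g [fN gN fK gK]].
pose F (h1 h2 : pmod k P) (h : forall p, 'Hom(h1 p, h2 p)) p :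
    'Hom(pmod_add K h1 p, pmod_add K h2 p) :=
  ((pinl K h2 p \o pfst K h1 p) + (pinr K h2 p \o h p \o psnd K h1 p))%VF.
have FE h1 h2 h p (x : pmod_add K h1 p) :
    @F h1 h2 h p x = (x.1, h p x.2) :> pmod_add K h2 p.
  rewrite add_lfunE !comp_lfunE pinlE pinrE pfstE psndE -[LHS]/(_, _) /=.
  by rewrite addr0 add0r.
exists (F M N f); split=> [p q pq|p].
  apply/lfunP=> x; rewrite 2!comp_lfunE FE !pmod_addE FE.
  by rewrite (naturalE _ _ fN).
by exists (F N M g p) => -[x y]; rewrite !FE /=
  ?(comp_eqE (fK p)) ?(comp_eqE (gK p)) id_lfunE.
Qed.

Lemma rk_iso d (P : finPOrderType d) (M N : pmod k P) (p : P) :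
  is_connected P -> pmod_iso M N -> rk M = rk N.
Proof.
move=> cP /pmod_iso_inverse[f [g [fN gN fK gK]]].
apply/eqP; rewrite eqn_leq (@rk_le _ _ _ _ _ _ _ id f g) //=.
  by rewrite (@rk_le _ _ _ _ _ _ _ id g f) // => q r qr; exists qr.
by move=> q r qr; exists qr.
Qed.

Lemma pmod_iso_pull d d' (Q : porderType d') (P : porderType d) (f : Q -> P)
    (f_homo : {homo f : x y / (x <= y)%O}) (M N : pmod k P) :
  pmod_iso M N -> pmod_iso (pmod_pull f_homo M) (pmod_pull f_homo N).
Proof.
case=> h [hN h_bij]; exists (fun q => h (f q)); split=> [p q pq|q].
  exact: hN.
exact: h_bij.
Qed.

(** The two records differ only in their proof fields, so Leibniz equality holds and ranks can be
    rewritten along it. *)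
Lemma pmod_pull_add d d' (Q : porderType d') (P : porderType d) (f : Q -> P)
    (f_homo : {homo f : x y / (x <= y)%O}) (M N : pmod k P) :
  pmod_pull f_homo (pmod_add M N) =
  pmod_add (pmod_pull f_homo M) (pmod_pull f_homo N).
Proof. by rewrite /pmod_pull /pmod_add; f_equal; apply: Prop_irrelevance. Qed.

Lemma dim_pmod_iso d (P : porderType d) (M N : pmod k P) p :
  pmod_iso M N -> dim (M p) = dim (N p).
Proof.
case/pmod_iso_inverse=> f [g [_ _ fK gK]]; apply/eqP; rewrite eqn_leq.
have le (X Y : vectType k) (u : 'Hom(X, Y)) (v : 'Hom(Y, X)) :
    (v \o u = \1)%VF -> (dim X <= dim Y)%N.
  move=> vu; rewrite -!dimvf -(@limg_dim_eq _ _ _ u fullv); first exact/dimvS/subvf.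
  apply/eqP; rewrite -subv0; apply/subvP=> x /memv_capP[_].
  by rewrite memv_ker memv0 => /eqP u0; rewrite -[x]id_lfunE -vu comp_lfunE u0 linear0.
by rewrite (le _ _ _ _ (fK p)) (le _ _ _ _ (gK p)).
Qed.

Lemma rk_le_dim d (P : finPOrderType d) (M : pmod k P) p :
  is_connected P -> (rk M <= dim (M p))%N.
Proof.
move=> cP; rewrite (rkE _ p cP) /lim_to_colim limg_comp.
by rewrite (leq_trans (dim_limg_le _ _)) // -dimvf dimvS ?subvf.
Qed.

(** By the universal properties, the composite [g p \o f p] factors through the canonical map from
    limit to colimit, which is therefore nonzero. *)
Lemma rk_gt0 d (P : finPOrderType d) (M : pmod k P) (X : vectType k)
    (f : forall p, 'Hom(X, M p)) (g : forall p, 'Hom(M p, X)) p x :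
  is_connected P -> cone f -> cocone g -> g p (f p x) != 0 -> (0 < rk M)%N.
Proof.
move=> cP fC gC; apply: contraNT; rewrite -eqn0Ngt (rkE _ p cP) dimv_eq0 => /eqP l0.
have [a [aE _]] := lim_univ fC; have [b [bE _]] := colim_univ gC.
rewrite -(comp_eqE (aE p)) -(comp_eqE (bE p)) -lim_to_colimE.
suff: lim_to_colim M p (a x) \in limg (lim_to_colim M p).
  by rewrite l0 memv0 => /eqP ->; rewrite linear0.
by rewrite memv_img ?memvf.
Qed.
End Isomorphisms.

(** * Interval modules and their ranks *)

Section IntervalModules.
Variables (k : fieldType) (d : Order.disp_t) (P : finPOrderType d).

(** For a boolean [t], rows of length [t] form a copy of [k] or the zero space. [row_sum] and
    [const_row] translate between such rows and scalars without a cast along the truth of [t]. *)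
Definition row_sum n (r : 'rV[k]_n) : k^o := \sum_i r 0 i.
Definition const_row n (c : k^o) : 'rV[k]_n := const_mx c.

Fact row_sum_linear n : linear (@row_sum n).
Proof.
move=> a r s; rewrite /row_sum scaler_sumr -big_split /=.
by apply: eq_bigr => i _; rewrite !mxE.
Qed.
Fact const_row_linear n : linear (@const_row n).
Proof. by move=> a b c; apply/rowP=> i; rewrite !mxE. Qed.
HB.instance Definition _ n :=
  GRing.isLinear.Build k _ _ _ (@row_sum n) (@row_sum_linear n).
HB.instance Definition _ n :=
  GRing.isLinear.Build k _ _ _ (@const_row n) (@const_row_linear n).

Lemma row_sum_const c (t : bool) : t -> row_sum (const_row t c) = c.
Proof. by case: t => // _; rewrite /row_sum big_ord1 mxE. Qed.

Lemma row_sum_const0 n : row_sum (const_row n 0) = 0.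
Proof. by rewrite /row_sum big1 // => i _; rewrite mxE. Qed.

Lemma row_sum0 (t : bool) (y : 'rV[k]_t) : ~~ t -> row_sum y = 0.
Proof. by case: t y => // y _; rewrite /row_sum big_ord0. Qed.

Lemma const_row0 (t : bool) c : ~~ t -> const_row t c = 0 :> 'rV[k]_t.
Proof. by case: t => // _; rewrite [LHS]thinmx0. Qed.

Lemma const_row_sum (t : bool) (r : 'rV[k]_t) : const_row t (row_sum r) = r.
Proof.
rewrite /row_sum; case: t r => r; last by rewrite [r]thinmx0 [LHS]thinmx0.
by rewrite big_ord1; apply/rowP=> i; rewrite !mxE [i]ord1.
Qed.

Lemma interval_modE (J : Defs.interval P) p q (pq : (p <= q)%O) x :
  pmap (interval_mod k J) pq x = const_row (q \in val J) (row_sum x).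
Proof.
rewrite lfunE /=; apply/rowP=> i; rewrite !mxE /row_sum.
by apply: eq_bigr => j _; rewrite !mxE mulr1.
Qed.

(** If [f] lands in [J], the pullback is a constant copy of [k], of rank one; otherwise one of its
    spaces is zero, and the rank is at most its dimension. *)
Lemma rk_pull_interval d' (Q : finPOrderType d') (f : Q -> P)
    (f_homo : {homo f : x y / (x <= y)%O}) (J : Defs.interval P) (q : Q) :
  is_connected Q ->
  rk (pmod_pull f_homo (interval_mod k J)) = [forall q, f q \in val J] :> nat.
Proof.
move=> cQ; have dimE p : dim (interval_mod k J p) = (p \in val J) :> nat.
  by rewrite /dim /= mul1n.
case: forallP => [fJ|/existsNP[q' fq']].
  apply/eqP; rewrite eqn_leq; apply/andP; split.
    by rewrite (leq_trans (rk_le_dim _ q cQ)) //= dimE fJ.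
  pose M := pmod_pull f_homo (interval_mod k J).
  pose u p : 'Hom(k^o, M p) := linfun (@const_row (f p \in val J)).
  pose v p : 'Hom(M p, k^o) := linfun (@row_sum (f p \in val J)).
  have vu p c : v p (u p c) = c by rewrite !lfunE /= row_sum_const.
  have ME p r (pr : (p <= r)%O) x : pmap M pr x = u r (v p x).
    by rewrite interval_modE !lfunE.
  have uC : cone u by move=> r s rs; apply/lfunP=> c; rewrite comp_lfunE ME vu.
  have vC : cocone v by move=> r s rs; apply/lfunP=> c; rewrite comp_lfunE ME vu.
  by apply: (rk_gt0 (p := q) (x := (1 : k^o)) cQ uC vC); rewrite vu oner_neq0.
apply/eqP; rewrite -leqn0 (leq_trans (rk_le_dim _ q' cQ)) //= dimE.
by move/negP/negbTE: fq' => ->.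
Qed.

Lemma rk_pull_sum d' (Q : finPOrderType d') (f : Q -> P)
    (f_homo : {homo f : x y / (x <= y)%O}) (B : seq (Defs.interval P)) (q : Q) :
  is_connected Q ->
  rk (pmod_pull f_homo (pmod_sum [seq interval_mod k J | J <- B])) =
  count (fun J : Defs.interval P => [forall r, f r \in val J]) B.
Proof.
move=> cQ; elim: B => [|J B IHB].
  by apply/eqP; rewrite -leqn0 (leq_trans (rk_le_dim _ q cQ)).
by rewrite /= pmod_pull_add rk_add // IHB rk_pull_interval.
Qed.

End IntervalModules.

(** * Direct summands and linear algebra *)

Section Splitting.
Variables (k : fieldType) (d : Order.disp_t) (P : finPOrderType d).

(** The complement is the kernel of [r], a submodule because [r] is natural; the isomorphism sends
    [x] to [r x] together with [x - i (r x)]. *)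
Lemma pmod_split (K M : pmod k P) (i : forall p, 'Hom(K p, M p))
    (r : forall p, 'Hom(M p, K p)) :
  natural i -> natural r -> (forall p, (r p \o i p = \1)%VF) ->
  exists Q : pmod k P, pmod_iso M (pmod_add K Q).
Proof.
move=> iN rN rK; pose V p : vectType k := subvs_of (lker (r p)).
(* [vsproj] serves only as corestriction: the structure maps of [M] already send kernel to
   kernel. *)
pose m p q (pq : (p <= q)%O) : 'Hom(V p, V q) :=
  (linfun (vsproj (lker (r q))) \o (pmap M pq \o linfun vsval))%VF.
have mE p q (pq : (p <= q)%O) (x : V p) : vsval (m p q pq x) = pmap M pq (vsval x).
  rewrite !comp_lfunE !lfunE /= vsprojK // memv_ker (naturalE _ _ rN).
  by have := subvsP x; rewrite memv_ker => /eqP ->; rewrite linear0.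
have m_id p (pp : (p <= p)%O) : m p p pp = \1%VF.
  by apply/lfunP=> x; apply: val_inj; rewrite /= mE pmap_id !id_lfunE.
have m_comp p q s (pq : (p <= q)%O) (qs : (q <= s)%O) (ps : (p <= s)%O) :
    m p s ps = (m q s qs \o m p q pq)%VF.
  apply/lfunP=> x; apply: val_inj.
  by rewrite /= comp_lfunE !mE (pmap_comp M pq qs ps) comp_lfunE.
pose Q := PMod m_id m_comp; exists Q.
pose c p : 'Hom(M p, Q p) :=
  (linfun (vsproj (lker (r p))) \o (\1 - (i p \o r p)))%VF.
have cE p x : vsval (c p x) = x - i p (r p x).
  rewrite comp_lfunE lfunE /= vsprojK; rewrite add_lfunE opp_lfunE comp_lfunE id_lfunE //.
  by rewrite memv_ker linearB /= (comp_eqE (rK p)) id_lfunE subrr.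
pose f p : 'Hom(M p, pmod_add K Q p) :=
  ((pinl K Q p \o r p) + (pinr K Q p \o c p))%VF.
have fE p x : f p x = (r p x, c p x) :> pmod_add K Q p.
  rewrite add_lfunE !comp_lfunE pinlE pinrE -[LHS]/(_, _) /=.
  by rewrite addr0 add0r.
exists f; split=> [p q pq|p].
  apply/lfunP=> x; rewrite 2!comp_lfunE pmod_addE !fE (naturalE _ _ rN) /=.
  congr (_, _); apply: val_inj; rewrite /= cE mE cE linearB /=.
  by rewrite (naturalE _ _ rN) (naturalE _ _ iN).
exists (fun x => i p x.1 + vsval x.2) => [x|[a b]]; rewrite fE /=.
  by rewrite cE addrC subrK.
have rb : r p (vsval b) = 0 by have := subvsP b; rewrite memv_ker => /eqP.
have ra : r p (i p a + vsval b) = a.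
  by rewrite linearD /= rb (comp_eqE (rK p)) id_lfunE addr0.
by congr (_, _) => //; apply: val_inj; rewrite /= cE ra addrC addKr.
Qed.

End Splitting.

Section LinearAlgebra.
Variable k : fieldType.

(** On [U] the kernel of [u] lies in that of [w], so any generalised inverse of [u] restricted to
    [U], followed by [w], is a factor. *)
Lemma lfun_factor (X Y Z : vectType k) (U : {vspace X}) (u : 'Hom(X, Y))
    (w : 'Hom(X, Z)) :
  (forall x, x \in U -> u x = 0 -> w x = 0) ->
  exists f : 'Hom(Y, Z), forall x, x \in U -> f (u x) = w x.
Proof.
move=> uw; pose u' : 'Hom(subvs_of U, Y) := (u \o linfun vsval)%VF.
have u'E y : u' y = u (vsval y) by rewrite comp_lfunE lfunE.
exists (w \o (linfun vsval \o u'^-1))%VF => x xU.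
have -> : x = vsval (vsproj U x) by rewrite vsprojK.
move: (vsproj U x) => {xU}y; rewrite -u'E.
have -> : (w \o (linfun vsval \o u'^-1))%VF (u' y) = w (vsval (u'^-1%VF (u' y))).
  by rewrite 2!comp_lfunE [linfun vsval _]lfunE.
apply/eqP; rewrite -subr_eq0 -!linearB; apply/eqP/uw; first exact: subvsP.
by rewrite -u'E linearB /= limg_lfunVK ?subrr // memv_img ?memvf.
Qed.

(** The projection along [U] kills [U] but not [v]; some coordinate of the projected [v] is
    nonzero. *)
Lemma lfun_separation (Y : vectType k) (U : {vspace Y}) (v : Y) : v \notin U ->
  exists2 f : 'Hom(Y, k^o), f v != 0 & forall x, x \in U -> f x = 0.
Proof.
move=> vU; pose c : 'Hom(Y, Y) := (\1 - projv U)%VF.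
have c0 x : x \in U -> c x = 0.
  by move=> xU; rewrite add_lfunE opp_lfunE id_lfunE projv_id ?subrr.
have cv : c v != 0.
  apply: contraNneq vU; rewrite add_lfunE opp_lfunE id_lfunE => /eqP.
  by rewrite subr_eq0 => /eqP ->; apply: memv_proj.
have [j cj] : exists j, coord (vbasis fullv) j (c v) != 0.
  apply: contrapT => /forallNP cj; case/eqP: cv.
  rewrite (coord_vbasis (memvf (c v))) big1 // => j _.
  by have /negP/negPn/eqP -> := cj j; rewrite scale0r.
exists (linfun (coord (vbasis fullv) j : Y -> k^o) \o c)%VF.
  by rewrite comp_lfunE lfunE.
by move=> x xU; rewrite comp_lfunE c0 // linear0.
Qed.

End LinearAlgebra.

(** * Sections and their pairing with cosections *)

Section Sections.
Variables (k : fieldType) (d : Order.disp_t) (P : finPOrderType d) (M : pmod k P).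
Implicit Types (D : P -> bool) (x y z : {dffun forall p, M p})
  (xi zeta : forall p, 'Hom(M p, k^o)).

(** Families are indexed by all of [P] and left free outside [D]. Thus sections over different [D]
    live in one space, and extending one to a new point only means choosing its value there. *)
Definition is_sec D x := forall p q (pq : (p <= q)%O),
  D p -> D q -> pmap M pq (x p) = x q.

Definition is_cosec D xi := forall p q (pq : (p <= q)%O),
  D p -> D q -> (xi q \o pmap M pq)%VF = xi p.

Definition sec_space D : {vspace {dffun forall p, M p}} :=
  (\bigcap_(p : P) \bigcap_(q : {q : P | (p <= q)%O})
     if D p && D (val q) then
       lker ((pmap M (valP q) \o dprod_proj M p)%VF - dprod_proj M (val q))
     else fullv)%VS.

Lemma sec_spaceP D x : reflect (is_sec D x) (x \in sec_space D).
Proof.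
apply: (iffP idP) => [|xM].
  rewrite memvE => /subv_bigcapP xP p q pq Dp Dq.
  have /subv_bigcapP/(_ (exist _ q pq) isT) := xP p isT.
  rewrite /= Dp Dq -memvE memv_ker add_lfunE opp_lfunE comp_lfunE !dprod_projE.
  rewrite subr_eq0 => /eqP <-.
  congr (fun_of_lfun (pmap M _) _); exact: bool_irrelevance.
rewrite memvE; apply/subv_bigcapP=> p _; apply/subv_bigcapP=> q _.
rewrite -memvE; case: ifP => [/andP[Dp Dq]|_]; last exact: memvf.
by rewrite memv_ker add_lfunE opp_lfunE comp_lfunE !dprod_projE xM ?subrr.
Qed.

Lemma cosec_sub D xi zeta : is_cosec D xi -> is_cosec D zeta ->
  is_cosec D (fun p => xi p - zeta p).
Proof.
move=> xiD zetaD p q pq Dp Dq; apply/lfunP=> y.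
rewrite comp_lfunE !add_lfunE !opp_lfunE.
by rewrite (comp_eqE (xiD _ _ pq Dp Dq)) (comp_eqE (zetaD _ _ pq Dp Dq)).
Qed.

(* The values at o and t of a section and those of a cosection are constrained
   only by each other. *)
Definition dual_ends D o t :=
  forall (f : 'Hom(M o, k^o)) (g : 'Hom(M t, k^o)),
    (forall x, is_sec D x -> f (x o) = g (x t)) ->
    exists xi, [/\ is_cosec D xi, xi o = f & xi t = g].

Definition pairing_trivial D := forall x xi, is_sec D x -> is_cosec D xi ->
  forall p, D p -> xi p (x p) = 0.

Definition adjoin D u p := D p || (p == u).

(* u is outside D, and t is the only point of D through which it is related to
   points of D. *)
Definition attached D t u := [/\ D t, ~~ D u, (t >=< u)%O & forall p, D p ->
  ((p <= u)%O -> (p <= t)%O && (t <= u)%O) /\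
  ((u <= p)%O -> (u <= t)%O && (t <= p)%O)].

(** Every relation between [u] and a point of [D] passes through [t], so compatibility between [u]
    and [t] suffices. *)
Lemma sec_adjoin D t u x : attached D t u -> is_sec D x ->
  (forall tu : (t <= u)%O, pmap M tu (x t) = x u) ->
  (forall ut : (u <= t)%O, pmap M ut (x u) = x t) -> is_sec (adjoin D u) x.
Proof.
move=> [Dt _ _ att] xD x_tu x_ut p q pq /orP[Dp|/eqP pu] /orP[Dq|/eqP qu].
- exact: xD.
- rewrite {q}qu in pq *; have /andP[pt tu] := (att p Dp).1 pq.
  by rewrite (pmap_comp M pt tu pq) comp_lfunE xD.
- rewrite {p}pu in pq *; have /andP[ut tq] := (att q Dq).2 pq.
  by rewrite (pmap_comp M ut tq pq) comp_lfunE x_ut xD.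
- by rewrite {p}pu {q}qu in pq *; rewrite pmap_id id_lfunE.
Qed.

Lemma cosec_adjoin D t u xi : attached D t u -> is_cosec D xi ->
  (forall tu : (t <= u)%O, (xi u \o pmap M tu)%VF = xi t) ->
  (forall ut : (u <= t)%O, (xi t \o pmap M ut)%VF = xi u) ->
  is_cosec (adjoin D u) xi.
Proof.
move=> [Dt _ _ att] xD x_tu x_ut p q pq /orP[Dp|/eqP pu] /orP[Dq|/eqP qu].
- exact: xD.
- rewrite {q}qu in pq *; have /andP[pt tu] := (att p Dp).1 pq.
  by rewrite (pmap_comp M pt tu pq) comp_lfunA x_tu xD.
- rewrite {p}pu in pq *; have /andP[ut tq] := (att q Dq).2 pq.
  by rewrite (pmap_comp M ut tq pq) comp_lfunA xD.
- by rewrite {p}pu {q}qu in pq *; rewrite pmap_id comp_lfun1r.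
Qed.

Definition set_sec x u (c : M u) : {dffun forall p, M p} :=
  [ffun p => dfwith (x : forall p, M p) c p].
Arguments set_sec : clear implicits.

Lemma set_sec_in x u c : set_sec x u c u = c.
Proof. by rewrite ffunE dfwith_in. Qed.

Lemma set_sec_out x u c p : u != p -> set_sec x u c p = x p.
Proof. by move=> up; rewrite ffunE dfwith_out. Qed.

Lemma eq_sec D x y : (forall p, D p -> x p = y p) -> is_sec D x -> is_sec D y.
Proof. by move=> xy xD p q pq Dp Dq; rewrite -!xy // xD. Qed.

Lemma eq_cosec D xi zeta : (forall p, D p -> xi p = zeta p) ->
  is_cosec D xi -> is_cosec D zeta.
Proof. by move=> xy xD p q pq Dp Dq; rewrite -!xy // xD. Qed.

Lemma is_sec_set D x u c : ~~ D u -> is_sec D x -> is_sec D (set_sec x u c).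
Proof.
move=> Du; apply: eq_sec => p Dp; rewrite set_sec_out //.
by apply: contraNneq Du => ->.
Qed.

Lemma is_cosec_set D xi u (c : 'Hom(M u, k^o)) : ~~ D u -> is_cosec D xi ->
  is_cosec D (dfwith xi c).
Proof.
move=> Du; apply: eq_cosec => p Dp; rewrite dfwith_out //.
by apply: contraNneq Du => ->.
Qed.

Lemma attachedN D t u p : attached D t u -> D p -> u != p.
Proof. by case=> _ Du _ _ Dp; apply: contraNneq Du => ->. Qed.

Lemma attached_lt_absurd D t u : attached D t u ->
  (t <= u)%O -> (u <= t)%O -> False.
Proof.
move=> att tu ut; have [Dt _ _ _] := att.
by have /eqP[] := attachedN att Dt; apply/le_anti; rewrite ut tu.
Qed.

Lemma sec0 D : is_sec D 0.
Proof. by move=> p q pq _ _; rewrite -!dprod_projE !linear0. Qed.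

Lemma secB D x y : is_sec D x -> is_sec D y -> is_sec D (x - y).
Proof. by move=> /sec_spaceP xD /sec_spaceP yD; apply/sec_spaceP/memvB. Qed.

(** The functional [g] at [u] is transferred to a functional at [t] to which the property over [D]
    applies; the cosection so obtained is then extended by [g]. *)
Lemma dual_ends_adjoin D o t u : D o -> attached D t u ->
  dual_ends D o t -> dual_ends (adjoin D u) o u.
Proof.
move=> Do att dD f g fg; have [Dt Du tu_cmp _] := att.
have un := attachedN att; have abs := attached_lt_absurd att.
case/orP: tu_cmp => [tu|ut].
  (* For [t <= u], a section over [D] extends uniquely to [u], so the functional at [t] is [g]
     pulled back along the arrow. *)
  have [x xD|xi [xiD xio xit]] := dD f (g \o pmap M tu)%VF.
    rewrite comp_lfunE -(set_sec_out x (pmap M tu (x t)) (un _ Do)) fg ?set_sec_in //.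
    apply: (sec_adjoin att); first exact: is_sec_set.
      by move=> tu'; rewrite set_sec_in set_sec_out ?un // (bool_irrelevance tu tu').
    by move=> ut; case: (abs tu ut).
  exists (dfwith xi g); split; [|by rewrite dfwith_out ?un|by rewrite dfwith_in].
  apply: (cosec_adjoin att); first exact: is_cosec_set.
    by move=> tu'; rewrite dfwith_in dfwith_out ?un // xit (bool_irrelevance tu tu').
  by move=> ut; case: (abs tu ut).
(* For [u <= t], an element of [sec_space D] has a free value at [u], and it is a section over the
   larger set when [x t] is the image of [x u]. On these [f (x o) - g (x u)] vanishes, hence it is a
   function [h] of the defect [x t - pmap M ut (x u)]. *)
have [|h hE] := @lfun_factor _ _ _ _ (sec_space D)
    (dprod_proj M t - (pmap M ut \o dprod_proj M u))%VF
    ((f \o dprod_proj M o) - (g \o dprod_proj M u))%VF.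
  move=> x /sec_spaceP xD; rewrite !add_lfunE !opp_lfunE !comp_lfunE !dprod_projE.
  move/eqP; rewrite subr_eq0 => /eqP xt; apply/eqP; rewrite subr_eq0; apply/eqP/fg.
  apply: (sec_adjoin att) => // [tu|ut']; first by case: (abs tu ut).
  by rewrite (bool_irrelevance ut' ut).
have {}hE x : is_sec D x -> h (x t) - h (pmap M ut (x u)) = f (x o) - g (x u).
  move/sec_spaceP/hE.
  by rewrite !add_lfunE !opp_lfunE !comp_lfunE !dprod_projE linearB.
(* Test the identity on the family that is [c] at [u] and zero elsewhere. *)
have hg : (h \o pmap M ut)%VF = g.
  apply/lfunP=> c; have /hE := is_sec_set c Du (@sec0 D).
  rewrite set_sec_in !set_sec_out ?un // -!dprod_projE !linear0 !sub0r.
  by rewrite comp_lfunE => /oppr_inj.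
have [x xD|xi [xiD xio xit]] := dD f h.
  have := hE x xD; rewrite -comp_lfunE hg => /eqP.
  by rewrite -subr_eq0 opprB addrA subrK subr_eq0 => /eqP.
exists (dfwith xi g); split; [|by rewrite dfwith_out ?un|by rewrite dfwith_in].
apply: (cosec_adjoin att) => [|tu|ut']; first exact: is_cosec_set.
  by case: (abs tu ut).
by rewrite dfwith_in dfwith_out ?un // xit -hg (bool_irrelevance ut' ut).
Qed.

(** For [u] attached at [t] exactly one of the two conditions is not vacuous, according to the
    direction of the arrow. These are the conditions for extending by zero beyond [t]. *)
Definition killed_at t u x xi :=
  (forall tu : (t <= u)%O, pmap M tu (x t) = 0) /\
  (forall ut : (u <= t)%O, (xi t \o pmap M ut)%VF = 0).

(** If the correction were impossible, [dual_ends] would produce a section and a cosection over the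
    larger set with nonzero pairing. For [u <= t] the argument is run directly, using the triviality
    of the pairing to construct the correction. *)
Lemma adjust_end D o t u x xi : D o -> attached D t u -> dual_ends D o t ->
  pairing_trivial (adjoin D u) -> is_sec D x -> is_cosec D xi ->
  exists y zeta, [/\ is_sec D y, is_cosec D zeta, y o = x o, zeta o = xi o &
    killed_at t u y zeta].
Proof.
move=> Do att dD trD xD xiD; have [Dt Du tu_cmp _] := att.
have un := attachedN att; have abs := attached_lt_absurd att.
case/orP: tu_cmp => [tu|ut].
  (* [U] collects the values at [u] that can be cancelled by subtracting a section that vanishes at
     [o]. *)
  pose U := ((pmap M tu \o dprod_proj M t) @:
    (sec_space D :&: lker (dprod_proj M o)))%VS.
  case: (boolP (pmap M tu (x t) \in U)) => [/memv_imgP[z]|xU].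
    case/memv_capP=> /sec_spaceP zD; rewrite memv_ker dprod_projE => /eqP zo.
    rewrite comp_lfunE dprod_projE => zt.
    exists (x - z), xi; split=> //; first exact: secB.
      by rewrite -!dprod_projE linearB /= !dprod_projE zo subr0.
    split=> [tu'|ut]; last by case: (abs tu ut).
    rewrite (bool_irrelevance tu' tu) -!dprod_projE linearB /= !dprod_projE.
    by rewrite linearB /= zt subrr.
  (* Otherwise some [g] kills [U] but not the image of [x t]. On sections, [g] at [u] then depends
     only on the value at [o], through some [f], and [dual_ends] realises both as one cosection. *)
  have [g gx gU] := lfun_separation xU.
  have [|f fE] := @lfun_factor _ _ _ _ (sec_space D) (dprod_proj M o)
      (g \o pmap M tu \o dprod_proj M t)%VF.
    move=> z zD zo; rewrite -comp_lfunA comp_lfunE gU // memv_img //.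
    by apply/memv_capP; rewrite memv_ker zo.
  have [z /sec_spaceP zD|zeta [zetaD _ zetat]] := dD f (g \o pmap M tu)%VF.
    by have := fE z zD; rewrite comp_lfunE !dprod_projE.
  (* Extending [x] by its image and [zeta] by [g] gives a pair over the larger set, whose pairing is
     trivial by assumption although [g] was chosen not to vanish. *)
  suff: zeta t (x t) = 0 by rewrite zetat comp_lfunE => /eqP; rewrite (negPf gx).
  pose x' := set_sec x u (pmap M tu (x t)); pose zeta' := dfwith zeta g.
  have <- : x' t = x t by rewrite set_sec_out ?un.
  have <- : zeta' t = zeta t by rewrite /zeta' dfwith_out ?un.
  apply: trD; last by rewrite /adjoin Dt.
    apply: (sec_adjoin att); first exact: is_sec_set.
      by move=> tu'; rewrite set_sec_in set_sec_out ?un // (bool_irrelevance tu tu').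
    by move=> ut; case: (abs tu ut).
  apply: (cosec_adjoin att); first exact: is_cosec_set.
    move=> tu'; rewrite /zeta' dfwith_in dfwith_out ?un // zetat.
    by rewrite (bool_irrelevance tu tu').
  by move=> ut; case: (abs tu ut).
(* For [u <= t], [xi] always extends to [u]. Triviality of its pairing is what allows the
   factorisation through [h] below. *)
have xi'D : is_cosec (adjoin D u) (dfwith xi (xi t \o pmap M ut)%VF).
  apply: (cosec_adjoin att) => [|tu|ut']; first exact: is_cosec_set.
    by case: (abs tu ut).
  by rewrite dfwith_in dfwith_out ?un // (bool_irrelevance ut' ut).
have [|h hE] := @lfun_factor _ _ _ _ (sec_space D)
    (dprod_proj M t - (pmap M ut \o dprod_proj M u))%VF
    (- (xi t \o pmap M ut \o dprod_proj M u))%VF.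
  move=> z /sec_spaceP zD; rewrite add_lfunE !opp_lfunE !comp_lfunE !dprod_projE.
  move/eqP; rewrite subr_eq0 => /eqP zt; rewrite -zt.
  have zD' : is_sec (adjoin D u) z.
    apply: (sec_adjoin att) => // [tu|ut']; first by case: (abs tu ut).
    by rewrite (bool_irrelevance ut' ut).
  have := trD _ _ zD' xi'D t; rewrite dfwith_out ?un // => -> //; rewrite ?oppr0 //.
  by rewrite /adjoin Dt.
have {}hE z : is_sec D z ->
    h (z t) - h (pmap M ut (z u)) = - xi t (pmap M ut (z u)).
  move/sec_spaceP/hE.
  by rewrite add_lfunE !opp_lfunE !comp_lfunE !dprod_projE linearB.
have hg : (h \o pmap M ut)%VF = (xi t \o pmap M ut)%VF.
  apply/lfunP=> c; have /hE := is_sec_set c Du (@sec0 D).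
  rewrite set_sec_in !set_sec_out ?un // -!dprod_projE !linear0 !sub0r.
  by rewrite !comp_lfunE => /oppr_inj.
(* By [hE] and [hg], [h] vanishes on the values at [t] of sections over [D], so it is the value at
   [t] of a cosection that is zero at [o]; subtracting that one leaves [xi o] unchanged. *)
have [z zD|zeta [zetaD zetao zetat]] := dD 0 h.
  rewrite zero_lfunE; apply/esym/eqP; have /eqP := hE z zD.
  by rewrite -comp_lfunE hg comp_lfunE -subr_eq0 opprK subrK.
exists x, (fun p => xi p - zeta p); split=> //; first exact: cosec_sub.
  by rewrite zetao subr0.
split=> [tu|ut']; first by case: (abs tu ut).
apply/lfunP=> c; rewrite (bool_irrelevance ut' ut) comp_lfunE add_lfunE opp_lfunE.
by rewrite zetat -!comp_lfunE hg subrr zero_lfunE.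
Qed.

End Sections.

(** * Zigzags *)

Section IntervalSummand.
Variables (k : fieldType) (d : Order.disp_t) (P : finPOrderType d) (M : pmod k P).

Definition scale_to (V : vectType k) (v : V) (c : k^o) : V := c *: v.
Fact scale_to_linear (V : vectType k) (v : V) : linear (scale_to v).
Proof. by move=> a b c; rewrite /scale_to scalerDl scalerA. Qed.
HB.instance Definition _ (V : vectType k) (v : V) :=
  GRing.isLinear.Build k _ _ _ (scale_to v) (scale_to_linear v).

(** [x] and [xi] define maps from the interval module to [M] and back. The vanishing hypotheses are
    naturality on the arrows crossing the boundary of [J]; on the opposite crossings the interval
    module has zero source or target. The pairing being one makes the composite the identity. *)
Lemma interval_summand (J : Defs.interval P) (x : {dffun forall p, M p})
    (xi : forall p, 'Hom(M p, k^o)) :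
  is_sec (fun p => p \in val J) x -> is_cosec (fun p => p \in val J) xi ->
  (forall p q (pq : (p <= q)%O), p \in val J -> q \notin val J ->
     pmap M pq (x p) = 0) ->
  (forall p q (pq : (p <= q)%O), p \notin val J -> q \in val J ->
     (xi q \o pmap M pq)%VF = 0) ->
  (forall p, p \in val J -> xi p (x p) = 1) ->
  exists Q, pmod_iso M (pmod_add (interval_mod k J) Q).
Proof.
move=> xJ xiJ x0 xi0 xi_x.
pose i p : 'Hom(interval_mod k J p, M p) :=
  (linfun (scale_to (x p)) \o linfun (@row_sum k (p \in val J)))%VF.
pose r p : 'Hom(M p, interval_mod k J p) :=
  (linfun (@const_row k (p \in val J)) \o xi p)%VF.
have iE p y : i p y = row_sum y *: x p by rewrite comp_lfunE !lfunE.
have rE p y : r p y = const_row (p \in val J) (xi p y) by rewrite comp_lfunE lfunE.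
apply: (@pmod_split _ _ _ _ _ i r) => [p q pq|p q pq|p]; apply/lfunP=> y.
- rewrite 2!comp_lfunE interval_modE !iE linearZ /=.
  case/orP: (orbN (p \in val J)) => pJ; last first.
    by rewrite (row_sum0 y) // row_sum_const0 !scale0r.
  case/orP: (orbN (q \in val J)) => qJ; first by rewrite row_sum_const // xJ.
  by rewrite (row_sum0 (const_row _ _)) // x0 // scale0r scaler0.
- rewrite 2!comp_lfunE interval_modE !rE.
  case/orP: (orbN (q \in val J)) => qJ; last by rewrite !const_row0.
  case/orP: (orbN (p \in val J)) => pJ.
    by rewrite row_sum_const // -comp_lfunE xiJ.
  by rewrite (row_sum0 (const_row _ _)) // -comp_lfunE xi0 // zero_lfunE.
rewrite comp_lfunE id_lfunE rE iE linearZ /=.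
case/orP: (orbN (p \in val J)) => pJ; first last.
  by rewrite const_row0 //; rewrite -(const_row_sum y) row_sum0 // linear0.
by rewrite xi_x // -[_ *: 1]/(_ * 1) mulr1 const_row_sum.
Qed.

End IntervalSummand.

Section Zigzags.
Variables (d : Order.disp_t) (P : porderType d) (G : seq P).
Implicit Types p q m s e u : zz G.

Lemma zz_point_nth x0 p : zz_point p = nth x0 G p.
Proof. by rewrite /zz_point (tnth_nth x0). Qed.

Lemma zz_arrow_le p q : zz_arrow p q -> (p <= q)%O.
Proof. exact: connect1. Qed.

(** A chain of arrows moves by one position at a time, so it visits every position between its
    ends. *)
Lemma zz_between p q m : (p <= q)%O -> (p <= m <= q)%N || (q <= m <= p)%N ->
  (p <= m)%O && (m <= q)%O.
Proof.
case/connectP=> c; elim: c p => [|p' c IHc] p /= => [_ -> pm|].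
  suff -> : m = p by rewrite lexx.
  by apply/val_inj/eqP; rewrite eqn_leq andbC; move: pm; rewrite orbb.
case/andP=> pp' p'c qE pm; have [mp|mp] := eqVneq m p.
  rewrite mp lexx /=; apply/connectP; exists (p' :: c) => //=.
  by rewrite pp' p'c.
have mp' : (m : nat) != p := mp.
have /(IHc _ p'c qE)/andP[p'm ->] : (p' <= m <= q)%N || (q <= m <= p')%N.
  case/andP: pp' => /orP[] /eqP pp' _; lia.
by rewrite (le_trans (zz_arrow_le pp') p'm).
Qed.

Definition zigzag := sorted (fun p q : P => (p < q)%O || (q < p)%O) G.

Lemma zz_step p q : zigzag -> q = p.+1 :> nat -> (p >=< q)%O.
Proof.
move=> Gz qE; have x0 := zz_point p.
have pG : (p.+1 < size G)%N by rewrite -qE.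
have := sortedP x0 Gz p pG; rewrite -qE -!zz_point_nth => pq.
apply/orP; case/orP: pq => pq; [left|right]; apply: zz_arrow_le;
  by rewrite /zz_arrow pq qE eqxx ?orbT.
Qed.

Definition zz_range s e p := (s <= p <= e)%N.

Lemma range_connect s e p q : zigzag -> zz_range s e p -> zz_range s e q ->
  connect (fun x y => [&& zz_range s e x, zz_range s e y & (x >=< y)%O]) p q.
Proof.
move=> Gz; wlog: p q / (p <= q)%N => [IH|].
  case/orP: (leq_total p q) => pq sp sq; first exact: IH.
  rewrite (sym_connect_sym _); first exact: IH.
  by move=> x y; rewrite andbCA comparable_sym.
move En : (q - p)%N => n; elim: n p En => [|n IHn] p En pq sp sq.
  have -> : p = q by apply: val_inj => /=; lia.
  exact: connect0.
have p1G : (p.+1 < size G)%N by have := ltn_ord q; lia.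
pose p1 : zz G := Ordinal p1G.
have sp1 : zz_range s e p1 by move: sp sq; rewrite /zz_range /=; lia.
apply: connect_trans (IHn p1 _ _ sp1 sq) => /=; [|lia|lia].
by apply: connect1; rewrite /= sp sp1 (zz_step Gz).
Qed.

Lemma zz_connected : zigzag -> is_connected (zz G).
Proof.
move=> Gz p q; have n0 : (0 < size G)%N by apply: leq_ltn_trans (ltn_ord p).
have n1 : ((size G).-1 < size G)%N by lia.
have R x : zz_range (Ordinal n0) (Ordinal n1) x.
  by rewrite /zz_range /=; have := ltn_ord x; lia.
have := range_connect Gz (R p) (R q); apply: connect_sub => x y /and3P[_ _ xy].
exact: connect1.
Qed.

Lemma range_is_interval s e : zigzag -> (s <= e)%N ->
  is_interval [set p | zz_range s e p].
Proof.
move=> Gz se; apply/and3P; split.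
- by apply/set0Pn; exists s; rewrite inE /zz_range leqnn.
- apply/forall_inP=> p; rewrite inE => sp; apply/forall_inP=> r; rewrite inE => sr.
  apply/forallP=> q; apply/implyP=> /andP[pq qr]; rewrite inE; apply/negPn/negP.
  move=> sq; have pq' : p <> q by move=> pq'; rewrite -pq' sp in sq.
  have rq' : r <> q by move=> rq; rewrite -rq sr in sq.
  (* As [q] is outside a range containing [p] and [r], the one of these nearer to [q] lies between
     [q] and the other; antisymmetry then identifies it with [q]. *)
  have [pr|rp] := boolP ((p <= r <= q)%N || (q <= r <= p)%N).
    have /andP[_ rq] := zz_between pq pr.
    by apply: rq'; apply: le_anti; rewrite rq qr.
  have pr' : (r <= p <= q)%N || (q <= p <= r)%N.
    by move: sq sp sr rp; rewrite /zz_range; lia.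
  have : (q <= p <= r)%N || (r <= p <= q)%N by rewrite orbC.
  case/(zz_between qr)/andP=> qp _.
  by apply: pq'; apply: le_anti; rewrite pq qp.
apply/forall_inP=> p; rewrite inE => sp; apply/forall_inP=> q; rewrite inE => sq.
have := range_connect Gz sp sq; apply: connect_sub => x y /and3P[sx sy xy].
by apply: connect1; rewrite !inE sx sy.
Qed.

(** If [m] were missing, convexity would forbid a relation between members of [J] on either side of
    it, so a chain of comparable members starting below [m] could never pass it. *)
Lemma interval_zz_contiguous (J : Defs.interval (zz G)) p q m :
  p \in val J -> q \in val J -> (p <= m <= q)%N -> m \in val J.
Proof.
case: J => J /= /and3P[_ cJ conJ] pJ qJ /andP[pm mq].
apply/negPn/negP=> mJ; have := forall_inP (forall_inP conJ p pJ) q qJ.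
have below x y : x \in J -> y \in J -> (x >=< y)%O -> (x < m)%N -> (y < m)%N.
  move=> xJ yJ xy xm; rewrite ltnNge; apply/negP=> my; case/negP: mJ.
  have cvx u v : u \in J -> v \in J -> (u <= v)%O ->
      (u <= m <= v)%N || (v <= m <= u)%N -> m \in J.
    move=> uJ vJ uv /(zz_between uv) umv.
    by have /forallP/(_ m) := forall_inP (forall_inP cJ u uJ) v vJ; rewrite umv.
  case/orP: xy => xy; first by apply: (cvx x y) => //; lia.
  by apply: (cvx y x) => //; lia.
have pm' : (p < m)%N.
  by rewrite ltn_neqAle pm andbT; apply: contraNneq mJ => /val_inj <-.
case/connectP=> c; elim: c p pJ pm' {pm} => [|y c IHc] x xJ xm /=.
  by move=> _ qE; move: xm; rewrite -qE ltnNge mq.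
by case/andP=> /and3P[_ yJ xy] yc qE; apply: (IHc y) => //; apply: (below x).
Qed.

Lemma range_attached_r s e u : zigzag -> (s <= e)%N -> u = e.+1 :> nat ->
  attached (zz_range s e) e u.
Proof.
move=> Gz se uE; split; rewrite ?/zz_range ?se ?leqnn ?uE ?ltnn ?andbF //.
  exact: zz_step.
move=> p /andP[sp pe]; split=> pu; apply: (zz_between pu); lia.
Qed.

Lemma range_attached_l s e u : zigzag -> (s <= e)%N -> s = u.+1 :> nat ->
  attached (zz_range s e) s u.
Proof.
move=> Gz se sE; split; rewrite ?/zz_range ?se ?leqnn ?sE ?ltnn ?andbF //.
  by rewrite comparable_sym; apply: zz_step.
move=> p /andP[sp pe]; split=> pu; apply: (zz_between pu); lia.
Qed.

Lemma range_adjoin_r s e u : (s <= e)%N -> u = e.+1 :> nat ->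
  adjoin (zz_range s e) u = zz_range s u.
Proof.
move=> se uE; apply/funext=> p; rewrite /adjoin /zz_range -val_eqE /=; lia.
Qed.

Lemma range_adjoin_l s e u : (s <= e)%N -> s = u.+1 :> nat ->
  adjoin (zz_range s e) u = zz_range u e.
Proof.
move=> se uE; apply/funext=> p; rewrite /adjoin /zz_range -val_eqE /=; lia.
Qed.

End Zigzags.

Lemma dual_ends_sym (k : fieldType) d (P : finPOrderType d) (M : pmod k P) D o t :
  dual_ends M D o t -> dual_ends M D t o.
Proof.
move=> dD f g fg; have [x xD|xi [xiD xio xit]] := dD g f; first exact/esym/fg.
by exists xi.
Qed.

(** * Interval decomposition of zigzag modules *)

Section Decomposition.
Variables (k : fieldType) (d : Order.disp_t) (P : porderType d) (G : seq P).
Hypothesis Gz : zigzag G.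
Implicit Types (M : pmod k (zz G)) (p q s e u : zz G).

Lemma range1 s p : zz_range s s p = (p == s).
Proof. by rewrite /zz_range -val_eqE /=; lia. Qed.

Lemma is_sec1 M s x : is_sec (M := M) (zz_range s s) x.
Proof.
move=> p q pq; rewrite !range1 => /eqP pE /eqP qE.
by rewrite {p}pE {q}qE in pq *; rewrite pmap_id id_lfunE.
Qed.

Lemma is_cosec1 M s xi : is_cosec (M := M) (zz_range s s) xi.
Proof.
move=> p q pq; rewrite !range1 => /eqP pE /eqP qE.
by rewrite {p}pE {q}qE in pq *; rewrite pmap_id comp_lfun1r.
Qed.

(** Induction on the length, adjoining the right end. Over one point every vector is the value of a
    section, which forces [f = g]. *)
Lemma dual_ends_range M s e : (s <= e)%N -> dual_ends M (zz_range s e) s e.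
Proof.
move En : (e - s)%N => n; elim: n e En => [|n IHn] e En se.
  have {En se} -> : e = s by apply/val_inj => /=; lia.
  move=> f g fg; exists (dfwith (fun p => 0 : 'Hom(M p, k^o)) f).
  split; [exact: is_cosec1|exact: dfwith_in|rewrite dfwith_in].
  apply/lfunP=> c; have := fg (set_sec 0 c) (@is_sec1 M s _).
  by rewrite !set_sec_in.
have e1G : (e.-1 < size G)%N by have := ltn_ord e; lia.
pose t : zz G := Ordinal e1G.
have st : (s <= t)%N by rewrite /=; lia.
have et : e = t.+1 :> nat by rewrite /=; lia.
rewrite -(range_adjoin_r st et).
apply: (dual_ends_adjoin _ (range_attached_r Gz st et)).
  by rewrite /zz_range leqnn.
by apply: IHn => //=; lia.
Qed.

(** For [p <= q], moving the structure map from the section to the cosection equates the two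
    pairings, and a range is connected. *)
Lemma pairing_const M s e x xi p q : is_sec (M := M) (zz_range s e) x ->
  is_cosec (zz_range s e) xi -> zz_range s e p -> zz_range s e q ->
  xi p (x p) = xi q (x q).
Proof.
move=> xD xiD sp sq.
case/connectP: (range_connect Gz sp sq) => c; elim: c p {sp} => [|r c IHc] p /=.
  by move=> _ ->.
case/andP=> /and3P[sp sr pr] rc qE; rewrite -(IHc r rc qE).
case/orP: pr => pr; first by rewrite -(xD _ _ pr) // -comp_lfunE xiD.
by rewrite -(xD _ _ pr) // -comp_lfunE xiD.
Qed.

Lemma nontrivial_range M p : (0 < dim (M p))%N -> ~ pairing_trivial M (zz_range p p).
Proof.
move=> Mp tr; pose c := vpick (fullv : {vspace M p}).
have [|f fc _] := @lfun_separation _ _ 0%VS c.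
  by rewrite memv0 vpick0 -dimv_eq0 dimvf -lt0n.
have := tr (set_sec 0 c) (dfwith (fun q => 0 : 'Hom(M q, k^o)) f).
have xD : is_sec (zz_range p p) (set_sec (0 : {dffun forall q, M q}) c).
  exact: is_sec1.
have xiD : is_cosec (zz_range p p) (dfwith (fun q => 0 : 'Hom(M q, k^o)) f).
  exact: is_cosec1.
move=> /(_ xD xiD p); rewrite set_sec_in dfwith_in range1 eqxx.
by move=> /(_ isT)/eqP; rewrite (negPf fc).
Qed.

(** A longest range with nontrivial pairing is taken; one exists because the single point [p]
    qualifies. *)
Lemma maximal_nontrivial_range M p : (0 < dim (M p))%N ->
  exists s e, [/\ (s <= e)%N, ~ pairing_trivial M (zz_range s e),
    forall u, u = e.+1 :> nat -> pairing_trivial M (zz_range s u) &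
    forall u, s = u.+1 :> nat -> pairing_trivial M (zz_range u e)].
Proof.
move=> Mp.
pose good (c : zz G * zz G) :=
  (c.1 <= c.2)%N && `[< ~ pairing_trivial M (zz_range c.1 c.2) >].
have good_p : good (p, p) by rewrite /good /= leqnn; apply/asboolP/nontrivial_range.
case: (@arg_maxnP _ (p, p) good (fun c => c.2 - c.1)%N good_p) => -[s e] /=.
case/andP=> /= se /asboolP ntr max; exists s, e; split=> // u uE.
  apply: contrapT => ntr'; have /max /= : good (s, u).
    by rewrite /good /=; apply/andP; split; [lia|apply/asboolP].
  lia.
apply: contrapT => ntr'; have /max /= : good (u, e).
  by rewrite /good /=; apply/andP; split; [lia|apply/asboolP].
lia.
Qed.

Lemma adjust_right M s e x xi : (s <= e)%N ->
  (forall u, u = e.+1 :> nat -> pairing_trivial M (zz_range s u)) ->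
  is_sec (zz_range s e) x -> is_cosec (zz_range s e) xi ->
  exists y zeta, [/\ is_sec (M := M) (zz_range s e) y, is_cosec (zz_range s e) zeta,
    y s = x s, zeta s = xi s &
    forall u, u = e.+1 :> nat -> killed_at e u y zeta].
Proof.
move=> se tr xD xiD; have [e1G|e1G] := ltnP e.+1 (size G); last first.
  (* When [e] is the last position there is no arrow to treat. *)
  by exists x, xi; split=> // u uE; have := ltn_ord u; lia.
pose u : zz G := Ordinal e1G; have uE : u = e.+1 :> nat by [].
have := adjust_end _ (range_attached_r Gz se uE) (dual_ends_range (M := M) se) _ xD xiD.
rewrite (range_adjoin_r se uE) /zz_range leqnn => /(_ se (tr u uE)).
case=> y [zeta [yD zetaD yo zetao kl]]; exists y, zeta; split=> // v vE.
by have -> : v = u by apply: val_inj; rewrite /= vE.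
Qed.

Lemma adjust_left M s e x xi : (s <= e)%N ->
  (forall u, s = u.+1 :> nat -> pairing_trivial M (zz_range u e)) ->
  is_sec (zz_range s e) x -> is_cosec (zz_range s e) xi ->
  exists y zeta, [/\ is_sec (M := M) (zz_range s e) y, is_cosec (zz_range s e) zeta,
    y e = x e, zeta e = xi e &
    forall u, s = u.+1 :> nat -> killed_at s u y zeta].
Proof.
move=> se tr xD xiD; have [s0|s0] := posnP s.
  by exists x, xi; split=> // u uE; lia.
have s1G : (s.-1 < size G)%N by have := ltn_ord s; lia.
pose u : zz G := Ordinal s1G; have uE : s = u.+1 :> nat by rewrite /=; lia.
have := adjust_end _ (range_attached_l Gz se uE)
  (dual_ends_sym (dual_ends_range (M := M) se)) _ xD xiD.
rewrite (range_adjoin_l se uE) /zz_range leqnn andbT => /(_ se (tr u uE)).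
case=> y [zeta [yD zetaD yo zetao kl]]; exists y, zeta; split=> // v vE.
by have -> : v = u by apply: val_inj; rewrite /=; lia.
Qed.

Lemma zz_interval_summand M p : (0 < dim (M p))%N ->
  exists (J : Defs.interval (zz G)) Q, pmod_iso M (pmod_add (interval_mod k J) Q).
Proof.
move=> /maximal_nontrivial_range[s [e [se ntr tr_r tr_l]]].
have [x0 [xi0 [x0D xi0D c0]]] : exists x xi,
    [/\ is_sec (M := M) (zz_range s e) x, is_cosec (zz_range s e) xi & xi s (x s) != 0].
  apply: contrapT => no; apply: ntr => x xi xD xiD q sq; apply/eqP/negPn/negP => c0.
  apply: no; exists x, xi; split=> //.
  by rewrite (pairing_const xD xiD (q := q)) // /zz_range leqnn.
have [x1 [xi1 [x1D xi1D x1s xi1s kl1]]] := adjust_right se tr_r x0D xi0D.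
(* This second adjustment fixes the values at [e], so the vanishing achieved there by the first one
   persists. *)
have [x2 [xi2 [x2D xi2D x2e xi2e kl2]]] := adjust_left se tr_l x1D xi1D.
have inr q : zz_range s e q -> xi2 q (x2 q) = xi0 s (x0 s).
  move=> sq; rewrite (pairing_const x2D xi2D (q := e)) ?/zz_range ?se ?leqnn //.
  rewrite x2e xi2e (pairing_const x1D xi1D (q := s)) ?/zz_range ?se ?leqnn //.
  by rewrite x1s xi1s.
pose J : Defs.interval (zz G) :=
  exist (fun J : {set zz G} => is_interval J) _ (range_is_interval Gz se).
have inJ q : (q \in val J) = zz_range s e q by rewrite inE.
(* A relation between the range and an outside position [q] crosses the boundary arrow joining an
   end [t] of the range to its outer neighbour [u], where the adjustments give vanishing. *)
have notin q : q \notin val J -> exists t u, [/\ zz_range s e t,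
    killed_at t u x2 xi2, forall r (rq : (r <= q)%O), zz_range s e r ->
      [/\ (r <= t)%O, (t <= u)%O & (u <= q)%O] &
      forall r (qr : (q <= r)%O), zz_range s e r ->
      [/\ (q <= u)%O, (u <= t)%O & (t <= r)%O]].
  rewrite inJ /zz_range negb_and -!ltnNge => /orP[qs|eq].
    have s1G : (s.-1 < size G)%N by have := ltn_ord s; lia.
    pose u : zz G := Ordinal s1G; have uE : s = u.+1 :> nat by rewrite /=; lia.
    exists s, u; split; first by rewrite leqnn.
    - exact: kl2.
    - move=> r rq sr.
      have /andP[rs sq] : (r <= s)%O && (s <= q)%O by apply: (zz_between rq); lia.
      by have /andP[] : (s <= u)%O && (u <= q)%O by apply: (zz_between sq) => /=; lia.
    move=> r qr sr.
    have /andP[qs' sr'] : (q <= s)%O && (s <= r)%O by apply: (zz_between qr); lia.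
    by have /andP[] : (q <= u)%O && (u <= s)%O by apply: (zz_between qs') => /=; lia.
  have e1G : (e.+1 < size G)%N by have := ltn_ord q; lia.
  pose u : zz G := Ordinal e1G; have uE : u = e.+1 :> nat by [].
  exists e, u; split; first by rewrite leqnn andbT.
  - case: (kl1 u uE) => k1 k2; split=> [eu|ue]; first by rewrite x2e k1.
    by rewrite xi2e k2.
  - move=> r rq sr.
    have /andP[re eq'] : (r <= e)%O && (e <= q)%O by apply: (zz_between rq); lia.
    by have /andP[] : (e <= u)%O && (u <= q)%O by apply: (zz_between eq') => /=; lia.
  move=> r qr sr.
  have /andP[qe er] : (q <= e)%O && (e <= r)%O by apply: (zz_between qr); lia.
  by have /andP[] : (q <= u)%O && (u <= e)%O by apply: (zz_between qe) => /=; lia.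
exists J; pose c := xi0 s (x0 s).
apply: (@interval_summand _ _ _ M J x2 (fun q => c^-1 *: xi2 q)).
- by move=> q r qr; rewrite !inJ; apply: x2D.
- move=> q r qr; rewrite !inJ => sq sr; apply/lfunP=> y.
  by rewrite comp_lfunE !scale_lfunE -(xi2D _ _ qr sq sr) comp_lfunE.
- move=> q r qr; rewrite inJ => sq /notin[t [u [st [kl _] into _]]].
  have [qt tu ur] := into q qr sq.
  rewrite (pmap_comp M qt (le_trans tu ur) qr) comp_lfunE (x2D _ _ qt) //.
  by rewrite (pmap_comp M tu ur) comp_lfunE kl linear0.
- move=> q r qr /notin[t [u [st [_ kl] _ outof]]]; rewrite inJ => sr.
  have [qu ut tr] := outof r qr sr; apply/lfunP=> y.
  rewrite comp_lfunE scale_lfunE (pmap_comp M qu (le_trans ut tr) qr).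
  rewrite (pmap_comp M ut tr) !comp_lfunE -[xi2 r _]comp_lfunE xi2D //.
  by rewrite -comp_lfunE kl !zero_lfunE -[_ *: _]/(_ * _) mulr0.
by move=> q; rewrite inJ => /inr sq; rewrite scale_lfunE sq -[_ *: _]/(_ * _) mulVf.
Qed.

(** Induction on the total dimension: a nonzero module splits off an interval module, and an
    interval is nonempty, so the complement is smaller. *)
Lemma zz_barcode M : exists B, barcode_of M B.
Proof.
move En : (\sum_p dim (M p))%N => n; elim/ltn_ind: n M En => n IHn M En.
have [[p Mp]|M0] := pselect (exists p, (0 < dim (M p))%N); last first.
  exists [::]; exists (fun p => 0); split=> [p q pq|p].
    by rewrite comp_lfun0l comp_lfun0r.
  exists (fun=> 0) => y; last by rewrite [LHS]thinmx0 [RHS]thinmx0.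
  apply/esym/eqP; rewrite -memv0; suff <- : fullv = 0%VS :> {vspace M p} by rewrite memvf.
  apply/eqP; rewrite -dimv_eq0 dimvf -leqn0 leqNgt; apply/negP=> Mp.
  by apply: M0; exists p.
have [J [Q MQ]] := zz_interval_summand Mp.
have dimE q : dim (M q) = ((q \in val J) + dim (Q q))%N.
  rewrite (dim_pmod_iso q MQ).
  transitivity (dim (interval_mod k J q) + dim (Q q))%N => //.
  by rewrite {1}/dim /= mul1n.
have [|B QB] := IHn _ _ Q erefl.
  rewrite -En; have /set0Pn[q qJ] : val J != finset.set0 by case/and3P: (valP J).
  rewrite (eq_bigr _ (fun q _ => dimE q)) big_split /= -[X in (X < _)%N]add0n ltn_add2r.
  by rewrite (bigD1 q) //= qJ.
by exists (J :: B); apply: pmod_iso_trans MQ (pmod_iso_add _ QB).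
Qed.

End Decomposition.

(** * Ranks of subpaths *)

Section Subpaths.
Variables (k : fieldType) (d : Order.disp_t) (P : porderType d) (M : pmod k P).
Implicit Types (G : seq P) (a b : nat).

(* [subpath], over an arbitrary poset. *)
Definition seg G a b := take (b.+1 - a) (drop a G).

Lemma pmod_pull_ext d' (Q : porderType d') (f g : Q -> P)
    (f_homo : {homo f : x y / (x <= y)%O}) (g_homo : {homo g : x y / (x <= y)%O}) :
  f =1 g -> pmod_pull f_homo M = pmod_pull g_homo M.
Proof.
move=> /funext fg; move: f_homo; rewrite fg => f_homo.
by rewrite (Prop_irrelevance f_homo g_homo).
Qed.

(** The case of [rk_le] with identity maps; it serves both for a path inside its hull and for a
    subpath inside a path. *)
Lemma rk_pull_le d' d'' (Q : finPOrderType d') (R : finPOrderType d'') (f : R -> Q)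
    (f_homo : {homo f : x y / (x <= y)%O}) (N : pmod k Q) (r : R) :
  is_connected Q -> is_connected R -> (rk N <= rk (pmod_pull f_homo N))%N.
Proof.
move=> cQ cR; apply: (@rk_le _ _ _ _ _ _ (pmod_pull f_homo N) f
  (fun=> \1%VF) (fun=> \1%VF) r) => // [q s qs|q]; last by rewrite comp_lfun1l.
by exists (f_homo _ _ qs); rewrite !comp_lfun1l !comp_lfun1r.
Qed.

Lemma size_seg G a b : (a <= b)%N -> (b < size G)%N -> size (seg G a b) = (b.+1 - a)%N.
Proof. by move=> ab bG; rewrite size_take size_drop; case: ltnP; lia. Qed.

Section Shift.
Variables (G : seq P) (a b : nat) (ab : (a <= b)%N) (bG : (b < size G)%N).

Lemma seg_ord_lt (i : zz (seg G a b)) : (i < b.+1 - a)%N.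
Proof. by rewrite -(size_seg ab bG). Qed.

Fact seg_pos_subproof (i : zz (seg G a b)) : (a + i < size G)%N.
Proof. by have := seg_ord_lt i; lia. Qed.

Definition seg_pos (i : zz (seg G a b)) : zz G := Ordinal (seg_pos_subproof i).

Lemma seg_pos_point i : zz_point (seg_pos i) = zz_point i.
Proof.
have x0 := zz_point i; rewrite !(zz_point_nth x0) /= nth_take ?nth_drop //.
exact: seg_ord_lt.
Qed.

Lemma seg_pos_homo : {homo seg_pos : i j / (i <= j)%O}.
Proof.
move=> i j /connectP[c]; elim: c i => [|h c IHc] i /= => [_ -> //|].
case/andP=> ih hc jE; apply: le_trans (IHc h hc jE); apply: zz_arrow_le.
by move: ih; rewrite /zz_arrow !seg_pos_point /= -!addnS !eqn_add2l.
Qed.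

Lemma zz_mod_seg : zz_mod M (seg G a b) = pmod_pull seg_pos_homo (zz_mod M G).
Proof. by apply: pmod_pull_ext => i; rewrite seg_pos_point. Qed.

Lemma zigzag_seg : zigzag G -> zigzag (seg G a b).
Proof. by move=> Gz; apply/take_sorted/drop_sorted. Qed.

Lemma seg_start_subproof : (0 < size (seg G a b))%N.
Proof. by rewrite size_seg //; lia. Qed.

Lemma rk_seg_le : zigzag G -> (rk (zz_mod M G) <= rk (zz_mod M (seg G a b)))%N.
Proof.
move=> Gz; rewrite zz_mod_seg; apply: rk_pull_le.
- exact: (Ordinal seg_start_subproof).
- exact: zz_connected.
exact/zz_connected/zigzag_seg.
Qed.

Definition spans (J : Defs.interval (zz G)) (a b : nat) :=
  [forall p : zz G, (a <= p <= b)%N ==> (p \in val J)].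

(** The module on the subpath is pulled back from that on [G], and a pulled-back bar has rank one or
    zero according to whether it contains the whole subpath. *)
Lemma rk_seg_barcode B : zigzag G -> barcode_of (zz_mod M G) B ->
  rk (zz_mod M (seg G a b)) = count (fun J => spans J a b) B.
Proof.
move=> Gz MB; have cL := zz_connected (zigzag_seg Gz).
pose i0 : zz (seg G a b) := Ordinal seg_start_subproof.
rewrite zz_mod_seg (rk_iso i0 cL (pmod_iso_pull _ MB)) (rk_pull_sum _ _ _ i0) //.
apply: eq_count => J; apply/forallP/forallP => [JL p|JG i].
  apply/implyP=> pab; have pL : (p - a < size (seg G a b))%N by rewrite size_seg //; lia.
  by have -> : p = seg_pos (Ordinal pL); [apply: val_inj => /=; lia|apply: JL].
apply: (implyP (JG (seg_pos i))) => /=.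
by have := seg_ord_lt i; lia.
Qed.

End Shift.

(** * Multiplicities by inclusion-exclusion *)

Section Counting.
Variables (G : seq P) (a b : nat) (ab : (a <= b)%N) (bG : (b < size G)%N).
Implicit Type J : Defs.interval (zz G).

Definition hits J n := [exists p : zz G, (p == n :> nat) && (p \in val J)].

Lemma spans_recr J m : (m <= b.+1)%N -> (b.+1 < size G)%N ->
  spans J m b.+1 = hits J b.+1 && spans J m b.
Proof.
move=> mb bG'; apply/forallP/andP=> [Jab|[/existsP[q /andP[/eqP qE qJ]] /forallP Jab] p].
  split; last by apply/forallP=> p; apply/implyP=> pab; apply: (implyP (Jab p)); lia.
  apply/existsP; exists (Ordinal bG'); rewrite eqxx /=.
  by apply: (implyP (Jab _)) => /=; lia.
apply/implyP=> pab; have [pb|pb] := eqVneq (p : nat) b.+1.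
  by have -> : p = q by apply: val_inj; rewrite /= qE.
by apply: (implyP (Jab p)); lia.
Qed.

Lemma spans_recl J n : (0 < a)%N -> (a.-1 <= n)%N ->
  spans J a.-1 n = hits J a.-1 && spans J a n.
Proof.
move=> a0 an; have aG : (a.-1 < size G)%N by lia.
apply/forallP/andP=> [Jab|[/existsP[q /andP[/eqP qE qJ]] /forallP Jab] p].
  split; last by apply/forallP=> p; apply/implyP=> pab; apply: (implyP (Jab p)); lia.
  apply/existsP; exists (Ordinal aG); rewrite eqxx /=.
  by apply: (implyP (Jab _)) => /=; lia.
apply/implyP=> pab; have [pa|pa] := eqVneq (p : nat) a.-1.
  by have -> : p = q by apply: val_inj; rewrite /= qE.
by apply: (implyP (Jab p)); lia.
Qed.

(** Bars are contiguous, so one that contains [[a, b]] and more must contain a neighbour [b.+1] or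
    [a.-1]; the guards cover the ends of [G], where no neighbour exists. *)
Lemma eq_seg_interval J :
  (val J == [set i : zz G | (a <= i <= b)%N]) =
  [&& spans J a b, ~~ ((b.+1 < size G)%N && hits J b.+1) & ~~ ((0 < a)%N && hits J a.-1)].
Proof.
apply/eqP/and3P=> [JE|[/forallP Jab /negP r /negP l]].
  split; first by apply/forallP=> p; apply/implyP; rewrite JE inE.
    by apply/negP=> /andP[_ /existsP[p /andP[/eqP pE]]]; rewrite JE inE; lia.
  by apply/negP=> /andP[a0 /existsP[p /andP[/eqP pE]]]; rewrite JE inE; lia.
apply/setP=> p; rewrite inE; apply/idP/idP=> [pJ|]; last exact: (implyP (Jab p)).
have aG : (a < size G)%N by lia.
apply/negPn/negP=> pab; have [pb|pb] := ltnP b p.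
  have bG' : (b.+1 < size G)%N by have := ltn_ord p; lia.
  apply: r; rewrite bG' /=; apply/existsP; exists (Ordinal bG'); rewrite eqxx /=.
  apply: (@interval_zz_contiguous _ _ _ J (Ordinal bG) p) => //=; last by lia.
  by apply: (implyP (Jab _)) => /=; lia.
have a0 : (0 < a)%N by lia.
have aG' : (a.-1 < size G)%N by lia.
apply: l; rewrite a0 /=; apply/existsP; exists (Ordinal aG'); rewrite eqxx /=.
apply: (@interval_zz_contiguous _ _ _ J p (Ordinal aG)) => //=; last by lia.
by apply: (implyP (Jab _)) => /=; lia.
Qed.

Definition rk_opt (o : option (seq P)) : nat := oapp (fun L => rk (zz_mod M L)) 0%N o.

Lemma count_seg_interval B : zigzag G -> barcode_of (zz_mod M G) B ->
  (count (fun J => val J == [set i : zz G | (a <= i <= b)%N]) B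
    + rk_opt (if (b.+1 < size G)%N then Some (seg G a b.+1) else None)
    + rk_opt (if (0 < a)%N then Some (seg G a.-1 b) else None)
  = rk (zz_mod M (seg G a b))
    + rk_opt (if (0 < a)%N && (b.+1 < size G)%N
              then Some (seg G a.-1 b.+1) else None))%N.
Proof.
move=> Gz MB.
have rkE_if (h : bool) m n : (h -> (m <= n)%N && (n < size G)%N) ->
    rk_opt (if h then Some (seg G m n) else None) =
    count (fun J => h && spans J m n) B.
  case: h => [/(_ isT)/andP[mn nG]|_]; last by rewrite count_pred0.
  by rewrite /= (rk_seg_barcode mn nG Gz MB).
rewrite !rkE_if; try lia.
rewrite (rk_seg_barcode ab bG Gz MB); elim: B {MB rkE_if} => //= J B IHB.
(* The contribution of one bar. With [S], [R], [L] the indicators of containing the subpath, its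
   right and its left neighbour, it reads [S(1-R)(1-L) + SR + SL = S + SRL], checked on booleans. *)
have : ((val J == [set i : zz G | (a <= i <= b)%N])
    + ((b.+1 < size G)%N && spans J a b.+1) + ((0 < a)%N && spans J a.-1 b)
  = spans J a b
    + ((0 < a)%N && (b.+1 < size G)%N && spans J a.-1 b.+1) :> nat)%N.
  have rE m : (m <= b.+1)%N -> (b.+1 < size G)%N && spans J m b.+1 =
      [&& (b.+1 < size G)%N, hits J b.+1 & spans J m b].
    by move=> mb; case: ltnP => // bG'; rewrite spans_recr.
  have lE n : (a.-1 <= n)%N -> (0 < a)%N && spans J a.-1 n =
      [&& (0 < a)%N, hits J a.-1 & spans J a n].
    by move=> an; case: posnP => // a0; rewrite spans_recl.
  have le1 : (a <= b.+1)%N by lia.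
  have le2 : (a.-1 <= b)%N by lia.
  have le3 : (a.-1 <= b.+1)%N by lia.
  move: (rE a le1) (lE b le2) (lE b.+1 le3); rewrite eq_seg_interval.
  move: (0 < a)%N (_ < size G)%N (spans J a b) (spans J a b.+1) (spans J a.-1 b)
    (spans J a.-1 b.+1) (hits J b.+1) (hits J a.-1).
  by do 8!case.
have add5 (x1 x2 x3 x4 x5 y1 y2 y3 y4 y5 : nat) :
    (x1 + x2 + x3 = x4 + x5 -> y1 + y2 + y3 = y4 + y5 ->
     (x1 + y1) + (x2 + y2) + (x3 + y3) = (x4 + y4) + (x5 + y5))%N by lia.
by move=> JE; apply: add5 JE IHB.
Qed.

End Counting.
End Subpaths.

(** * Hulls, tame subpaths and the two estimates *)

Section Paths.
Implicit Types (p q : Z2) (G L : seq Z2).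

Lemma faithful_zigzag G : faithful_path G -> zigzag G.
Proof.
case/andP=> _; apply: sub_sorted => p q.
by case/orP=> /andP[pq _]; rewrite pq ?orbT.
Qed.

Lemma zz_point_hull G (i : zz G) : zz_point i \in hull G.
Proof.
by apply/hullP; exists (zz_point i), (zz_point i); rewrite mem_tnth lexx.
Qed.

Definition hull_pos G (i : zz G) : subposet (hull G) := [` zz_point_hull i]%fset.

Lemma hull_pos_homo G : {homo @hull_pos G : i j / (i <= j)%O}.
Proof. by move=> i j ij; apply: (zz_point_homo ij). Qed.

(** Each point of the hull lies above a point of [G], and [G] itself is connected. *)
Lemma hull_connected G : zigzag G -> is_connected (subposet (hull G)).
Proof.
move=> Gz.
have sym : connect_sym (fun x y : subposet (hull G) => (x >=< y)%O).
  by apply: sym_connect_sym => x y; rewrite comparable_sym.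
have to_G (x : subposet (hull G)) :
    exists i : zz G, connect (fun x y => (x >=< y)%O) x (hull_pos i).
  case: x => x xG; have /hullP[p [r [pG _ /andP[px _]]]] := xG.
  have /tnthP[i pE] : p \in in_tuple G by [].
  exists i; apply: connect1; rewrite comparable_sym; apply: le_comparable.
  by rewrite leEsub /= /zz_point -pE.
move=> x y; have [i xi] := to_G x; have [j yj] := to_G y.
apply: connect_trans xi _; apply: connect_trans _ _; last by rewrite sym; exact: yj.
case/connectP: (zz_connected Gz i j) => c; elim: c i => [|h c IHc] i /=.
  by move=> _ ->; apply: connect0.
case/andP=> ih hc jE; apply: connect_trans (IHc h hc jE); apply: connect1.
by case/orP: ih => /hull_pos_homo ih; rewrite /Order.comparable ih ?orbT.
Qed.

Section Bounds.
Variables (k : fieldType) (M : pmod k Z2).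

Lemma m_rk_le G : faithful_path G -> (m_rk M G <= rk (zz_mod M G))%N.
Proof.
move=> Gp; have Gz := faithful_zigzag Gp.
have G0 : (0 < size G)%N by case/andP: Gp; case: (G).
have -> : zz_mod M G = pmod_pull (@hull_pos_homo G) (restrict M (hull G)).
  exact: pmod_pull_ext.
apply: rk_pull_le; [exact: (Ordinal G0)|exact: hull_connected|exact: zz_connected].
Qed.

(** The hull of a single point is that point, and so are both of its zigzag paths. This makes the
    minimum in [l_rk] range over a nonempty list. *)
Lemma tame1 p : tame [:: p].
Proof.
have hull1 : hull [:: p] = [fset p]%fset.
  apply/fsetP=> q; rewrite in_fset1; apply/hullP/eqP=> [[x [y []]]|->].
    by rewrite !inE => /eqP -> /eqP -> /le_anti ->.
  by exists p, p; rewrite !inE lexx.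
have short1 : shortest_through [:: p] [:: p].
  by split=> [||L' /andP[L0 _] _]; rewrite ?subseq_refl //; case: L' L0.
have inf1 : infix [:: p] [:: p] by exact: infix_refl.
have enum1 : enum_fset [fset p]%fset = [:: p].
  apply: perm_small_eq => //; apply: uniq_perm => // q.
  by rewrite [LHS]in_fset1 inE.
by split; exists [:: p]; rewrite ?inf1 // hull1;
  rewrite /is_min_ZZ /is_max_ZZ /min_points /max_points enum1 /= ltxx.
Qed.

Lemma leq_bigmin c h (s : seq nat) : (c <= h)%N -> (forall r, r \in s -> (c <= r)%N) ->
  (c <= \big[minn/h]_(r <- s) r)%N.
Proof.
move=> ch cs; rewrite big_seq.
by elim/big_ind: _ => // m n cm cn; rewrite leq_min cm.
Qed.

Lemma l_rk_ge G : faithful_path G -> (rk (zz_mod M G) <= l_rk M G)%N.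
Proof.
move=> Gp; have Gz := faithful_zigzag Gp.
rewrite /l_rk; set rs := [seq _ | L <- _ & _].
have rs_ge r : r \in rs -> (rk (zz_mod M G) <= r)%N.
  case/mapP=> L; rewrite mem_filter => /andP[_ /allpairsPdep[a [b []]]].
  have bnd (m n s : nat) : (0 <= m < 0 + s -> m <= n < m + (s - m) ->
      (m <= n) && (n < s))%N by lia.
  rewrite !mem_iota => aG /(bnd _ _ _ aG)/andP[ab bG] -> ->.
  exact: rk_seg_le.
apply: leq_bigmin => //; apply: rs_ge.
(* The initial value of the minimum is the head of [rs]. The first point of [G] is a tame subpath,
   so [rs] is nonempty and its head is a genuine rank. *)
have [p0 G0] : exists p, subpath G 0 0 = [:: p].
  by case/andP: Gp; case: (G) => // p L _ _; exists p; rewrite /subpath /= take0.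
have : rk (zz_mod M [:: p0]) \in rs.
  apply: map_f; rewrite mem_filter; apply/andP; split; first exact/asboolP/tame1.
  have sG : (0 < size G)%N by case/andP: Gp; case: (G).
  rewrite -G0; apply: allpairs_f_dep; rewrite mem_iota; lia.
by case: (rs) => // r s _; rewrite inE eqxx.
Qed.

Lemma faithful_seg G a b : (a <= b)%N -> (b < size G)%N -> faithful_path G ->
  faithful_path (subpath G a b).
Proof.
move=> ab bG /andP[_ Gs]; apply/andP; split; last exact/take_sorted/drop_sorted.
by rewrite -size_eq0 (size_seg ab bG) -lt0n; lia.
Qed.

End Bounds.
End Paths.

(** * The two bounds on the multiplicity *)

Lemma bounds_of_ranks (n mG rG lG mp rp lp mm rm lm mpm rpm lpm : nat) :
  (mG <= rG <= lG)%N -> (mp <= rp <= lp)%N -> (mm <= rm <= lm)%N ->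
  (mpm <= rpm <= lpm)%N -> (n + rp + rm = rG + rpm)%N ->
  mG%:Z - lp%:Z - lm%:Z + mpm%:Z <= n%:Z <= lG%:Z - mp%:Z - mm%:Z + lpm%:Z.
Proof. lia. Qed.

Theorem proposition4p22 (k : fieldType) (M : pmod k Z2) (G : seq Z2)
    (G_path : faithful_path G) (G_simple : uniq G)
    (a b : nat) (le_ab : (a <= b)%N) (lt_b : (b < size G)%N) :
  let G' := subpath G a b in
  (m_rk M G')%:Z - l_opt M (ext_plus G a b) - l_opt M (ext_minus G a b)
    + m_opt M (ext_pm G a b)
  <= (mult M G a b)%:Z
  <= (l_rk M G')%:Z - m_opt M (ext_plus G a b) - m_opt M (ext_minus G a b)
    + l_opt M (ext_pm G a b).
Proof.
have Gz := faithful_zigzag G_path.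
have [B0 B0P] := zz_barcode Gz (zz_mod M G).
(* [barc] is a choice with default [[::]]; existence of a decomposition ensures that the chosen list
   is one. *)
have BP : barcode_of (zz_mod M G) (barc (zz_mod M G)) :=
  @xgetPex _ [::] _ (ex_intro _ _ B0P).
have m_optE o : m_opt M o = (oapp (m_rk M) 0%N o)%:Z by case: o.
have l_optE o : l_opt M o = (oapp (l_rk M) 0%N o)%:Z by case: o.
(* An absent extension contributes zero to all three terms, so the estimates hold in that case
   too. *)
have bounds (h : bool) m n : (h -> (m <= n)%N && (n < size G)%N) ->
    let o := if h then Some (subpath G m n) else None in
    (oapp (m_rk M) 0%N o <= rk_opt M o <= oapp (l_rk M) 0%N o)%N.
  case: h => //= /(_ isT)/andP[mn nG].
  by have Lp := faithful_seg mn nG G_path; rewrite /rk_opt /= m_rk_le ?l_rk_ge.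
have le_a1b : (a.-1 <= b)%N by lia.
cbv zeta; rewrite !m_optE !l_optE.
apply: bounds_of_ranks (count_seg_interval le_ab lt_b Gz BP).
- by apply: (bounds true) => _; rewrite le_ab.
- by apply: bounds; rewrite leqW.
- by apply: bounds; rewrite le_a1b.
- by apply: bounds => /andP[_ ->]; rewrite leqW.
Qed.
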